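(* Let $p$ be a prime and $\frac{p-1}{p}<\delta<1$. Let $\mathbb{K}$ be a finite field, $n$ a positive integer, and $C\subseteq\mathbb{F}_p^{\mathbb{K}^n}$ a single orbit affine invariant code with defining constraint $\underline{e}_0$ of support size $k=|\operatorname{supp}(\underline{e}_0)|$, such that $$|\mathbb{K}|^n\ge k^4\,\frac{128(1+15\delta)}{7(1-\delta)^2}.$$ Then for every $\underline{c}\in\mathbb{F}_p^{\mathbb{K}^n}$, $$\operatorname{rej}(\underline{c})\ge k\cdot\frac{7(1-\delta)^3(\delta-\frac{p-1}{p})}{512(1+15\delta)}\cdot\min\left\{\min_{\underline{c}'\in C}\|\underline{c}-\underline{c}'\|,\ \frac1{k^3}\right\}.$$ (That is, the family of all such codes is amplified locally testable with $r=\frac{7(1-\delta)^3(\delta-\frac{p-1}{p})}{512(1+15\delta)}$ and $t=3$.)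
   Context: The affine group $\operatorname{Aff}(\mathbb{K}^n)$ consists of pairs $(\underline{y},L)$ with $\underline{y}\in\mathbb{K}^n$, $L\in\operatorname{GL}(\mathbb{K}^n)$, acting on $\mathbb{K}^n$ by $(\underline{y},L).\underline{x}=L\underline{x}+\underline{y}$, and on functions $f\in\mathbb{F}_p^{\mathbb{K}^n}$ by $(g.f)(\underline{x})=f(g^{-1}.\underline{x})$. A single orbit affine invariant code is defined by fixing $\underline{e}_0\in\mathbb{F}_p^{\mathbb{K}^n}$ taking values in $\{0,1\}$ with $|\operatorname{supp}(\underline{e}_0)|\ge2$, and setting $C=\{\underline{c}\in\mathbb{F}_p^{\mathbb{K}^n}:(g.\underline{e}_0)\cdot\underline{c}=0\ \forall g\in\operatorname{Aff}(\mathbb{K}^n)\}$, where $\underline{e}\cdot\underline{c}=\sum_{\underline{x}}\underline{e}(\underline{x})\underline{c}(\underline{x})$. Let $\tau_0=\operatorname{supp}(\underline{e}_0)$ and $E=\{g.\tau_0:g\in\operatorname{Aff}(\mathbb{K}^n)\}$ (the set of distinct supports of the constraints). Then $\operatorname{rej}(\underline{c})=\frac{|\{\tau\in E:\sum_{\underline{x}\in\tau}\underline{c}(\underline{x})\neq0\}|}{|E|}$ is the fraction of constraints violated, and $\|\underline{c}-\underline{c}'\|=\frac{|\{\underline{x}\in\mathbb{K}^n:\underline{c}(\underline{x})\ne\underline{c}'(\underline{x})\}|}{|\mathbb{K}|^n}$ is the normalized Hamming distance. *)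

(* Defs.v *)
From HB Require Import structures.
From mathcomp Require Import all_boot all_order all_algebra.
Set Implicit Arguments. Unset Strict Implicit. Unset Printing Implicit Defensive.
Import Order.TTheory GRing.Theory Num.Theory.
Local Open Scope ring_scope.

Notation fn p K n := {ffun 'cV[K]_n -> 'F_p}.

Definition affine_group (K : finFieldType) (n : nat) : {set 'cV[K]_n * 'M[K]_n} :=
  [set g | g.2 \in unitmx].

Definition aff_pt (K : finFieldType) (n : nat) (g : 'cV[K]_n * 'M[K]_n)
  (x : 'cV[K]_n) : 'cV[K]_n := g.2 *m x + g.1.

Definition aff_pt_inv (K : finFieldType) (n : nat) (g : 'cV[K]_n * 'M[K]_n)
  (x : 'cV[K]_n) : 'cV[K]_n := invmx g.2 *m (x - g.1).

Definition aff_fun (p : nat) (K : finFieldType) (n : nat)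
  (g : 'cV[K]_n * 'M[K]_n) (f : fn p K n) : fn p K n :=
  [ffun x => f (aff_pt_inv g x)].

Definition dotf (p : nat) (K : finFieldType) (n : nat) (e c : fn p K n) : 'F_p :=
  \sum_x e x * c x.

Definition supp (p : nat) (K : finFieldType) (n : nat) (f : fn p K n)
  : {set 'cV[K]_n} := [set x | f x != 0].

Definition aff_code (p : nat) (K : finFieldType) (n : nat) (e0 : fn p K n)
  : {set fn p K n} :=
  [set c | [forall g in affine_group K n, dotf (aff_fun g e0) c == 0]].

Definition constraint_supports (p : nat) (K : finFieldType) (n : nat)
  (e0 : fn p K n) : {set {set 'cV[K]_n}} :=
  [set supp (aff_fun g e0) | g in affine_group K n].

Definition rej (R : realFieldType) (p : nat) (K : finFieldType) (n : nat)
  (e0 c : fn p K n) : R :=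
  (#|[set tau in constraint_supports e0 | (\sum_(x in tau) c x) != 0]|)%:R
  / (#|constraint_supports e0|)%:R.

Definition ham (p : nat) (K : finFieldType) (n : nat) (c c' : fn p K n) : nat :=
  #|[set x | c x != c' x]|.

(* min_{c' in C} ||c - c'|| (normalized by |K|^n); the default value
   |K^n| of the nat-min is never smaller than any actual distance. *)
Definition dist_to_code (R : realFieldType) (p : nat) (K : finFieldType) (n : nat)
  (e0 c : fn p K n) : R :=
  (\big[minn/#|{: 'cV[K]_n}|]_(c' in aff_code e0) ham c c')%:R / (#|K| ^ n)%:R.

(* Main.v *)
(* Write V for K^n, N for |K|^n, k for the support size, and translate the
   support to a set D containing 0, so that the constraints read
   sum_(d in D) c (z + X d) = 0 with z in V and X in GL_n(K). If the rejection
   probability is at least r / k^2 there is nothing to prove. Otherwise c is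
   self-corrected: for A, B in GL_n the array x + A d + B d' has constraints as
   rows and columns, so for fixed x the value - sum_(d <> 0) c (x + A d) is the
   same for almost all A; call it f x. Every x with c x <> f x lies on mostly
   violated constraints, so f is close to c.

   That f satisfies a given constraint (x, A) follows from an array whose first
   column is that constraint and whose other rows and columns are close to
   random constraints. It is obtained by twisting x + A d + B d' with a bilinear
   term, and the multiplication of the field L with |L| = N, seen as an n-dimensional
   algebra of matrices, provides one that keeps rows and columns invertible. When
   n < 4k the column matrices are A times conjugates of random elements of L; a generic
   such conjugate takes each value with probability at most n / |GL_n|, a loss that
   the bound r / k^2 absorbs. When n >= 4k, a uniformly random matrix is almost
   surely injective on the span of D, and plain uniform matrices suffice.

   Finally, since c differs from the codeword f on a sparse set S, 2-transitivity
   shows that about k |S| / N of the constraints meet S exactly once, and these are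
   violated: this is the factor k. *)
Require Import Defs.
From HB Require Import structures.
From mathcomp Require Import all_boot all_order all_fingroup all_algebra.
From mathcomp Require Import all_solvable all_field.
From mathcomp Require Import zify ring lra.
Set Implicit Arguments. Unset Strict Implicit. Unset Printing Implicit Defensive.
Import Order.TTheory GRing.Theory Num.Theory.
Local Open Scope ring_scope.

(** * Counting *)

Lemma card_le_fibers (T U : finType) (A : {set T}) (B : {set U}) (phi : T -> U)
    (m : nat) :
  {in A, forall x, phi x \in B} ->
  {in B, forall y, #|[set x in A | phi x == y]| <= m}%N ->
  (#|A| <= m * #|B|)%N.
Proof.
move=> AB Bm; rewrite -sum1_card (partition_big phi (mem B)) //=.
apply: leq_trans (_ : _ <= \sum_(y in B) m)%N _; last by rewrite sum_nat_const mulnC.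
apply: leq_sum => y By; apply: leq_trans (Bm y By).
by rewrite -sum1_card; apply/eq_leq/eq_bigl => x; rewrite inE.
Qed.

Lemma card_le_inj (T U : finType) (A : {set T}) (B : {set U}) (phi : T -> U) :
  {in A, forall x, phi x \in B} -> {in A &, injective phi} -> (#|A| <= #|B|)%N.
Proof.
move=> AB inj; rewrite -(card_in_imset inj); apply/subset_leq_card/subsetP.
by move=> _ /imsetP[x Ax ->]; apply: AB.
Qed.

Lemma card_bigcup_le (I T : finType) (D : {set I}) (E : I -> {set T}) (m : nat) :
  {in D, forall d, #|E d| <= m}%N -> (#|\bigcup_(d in D) E d| <= #|D| * m)%N.
Proof.
move=> Em; rewrite -sum_nat_const.
elim/big_rec2: _ => [|d x A Dd le]; first by rewrite cards0.
by apply: leq_trans (leq_card_setU _ _) (leq_add _ _) => //; apply: Em.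
Qed.

Lemma card_pair_suml (T U : finType) (P : T -> U -> bool) :
  #|[set u : T * U | P u.1 u.2]| = (\sum_a #|[set b | P a b]|)%N.
Proof.
rewrite -sum1dep_card -(pair_big_dep xpredT P (fun _ _ => 1%N)) /=.
by apply: eq_bigr => a _; rewrite sum1dep_card.
Qed.

Lemma card_pair_sumr (T U : finType) (P : T -> U -> bool) :
  #|[set u : T * U | P u.1 u.2]| = (\sum_b #|[set a | P a b]|)%N.
Proof.
rewrite -sum1dep_card -(pair_big_dep xpredT P (fun _ _ => 1%N)) /=.
rewrite (exchange_big_dep xpredT) //=.
by apply: eq_bigr => a _; rewrite sum1dep_card.
Qed.

(** Turns a proportion of group elements into the same proportion of distinct supports, once all
    fibers of the orbit map have one size [m]. *)
Lemma card_uniform_fibers (T U : finType) (A : {set T}) (phi : T -> U) (m : nat)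
    (P : pred U) :
  {in phi @: A, forall y, #|[set x in A | phi x == y]| = m} ->
  #|[set x in A | P (phi x)]| = (m * #|[set y in phi @: A | P y]|)%N.
Proof.
move=> Hm; rewrite -[LHS]sum1dep_card.
rewrite (partition_big phi (mem [set y in phi @: A | P y])) /=; last first.
  by move=> x /andP[Ax Px]; rewrite inE Px imset_f.
rewrite mulnC -sum_nat_const; apply: eq_bigr => y; rewrite inE => /andP[yA Py].
rewrite sum1dep_card -(Hm y yA); apply: eq_card => x; rewrite !inE.
by case: (x \in A) => //=; have [->|] := eqVneq (phi x) y; rewrite ?Py ?andbF.
Qed.

Lemma bigminn_le (I : finType) (P : pred I) (F : I -> nat) (x : nat) (j : I) :
  P j -> (\big[minn/x]_(i | P i) F i <= F j)%N.
Proof.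
move=> Pj; have : j \in index_enum I by rewrite mem_index_enum.
elim: (index_enum I) => // i r IH; rewrite inE big_cons => /predU1P[<-|/IH le].
  by rewrite Pj geq_minl.
by case: (P i) => //; apply: leq_trans (geq_minr _ _) le.
Qed.

(** * Finite field extensions as matrix algebras *)

Section FiniteFieldExtension.
Import VectorInternalTheory.

Lemma card_finvect_type (K : finFieldType) (vT : vectType K) :
  #|finvect_type vT| = (#|K| ^ \dim {:vT})%N.
Proof.
rewrite dimvf -[dim vT in RHS]mul1n -card_mx.
apply: (@bij_eq_card (finvect_type vT) _ v2r).
by exists r2v; [exact: v2rK | exact: r2vK].
Qed.

(** [L] is the splitting field of [X^m - X] with [m = |K|^n]. This polynomial is separable, its
    derivative being -1, and its roots form a field, so they exhaust [L] and [|L| = m]. *)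
Lemma finField_ext_exists (K : finFieldType) (n : nat) :
  (0 < n)%N -> exists L : fieldExtType K, \dim {:L} = n.
Proof.
move=> n_gt0; set m := (#|K| ^ n)%N.
have m_gt1 : (1 < m)%N by rewrite -(exp1n n) ltn_exp2r // finNzRing_gt1.
pose P (F : nzRingType) : {poly F} := 'X^m - 'X.
have sizeP F : size (P F) = m.+1.
  by rewrite size_polyDl size_polyXn // size_polyN size_polyX.
have /FinSplittingFieldFor[/= L splitL] : P K != 0.
  by rewrite -size_poly_gt0 sizeP.
rewrite /P rmorphB rmorphXn /= map_polyX -/(P L) in splitL.
have [zs DP defL] := splitL.
have m0 : m%:R = 0 :> L.
  have [c c_pr cK] := finPcharP K.
  have cL : c \in [pchar L] by rewrite pchar_lalg.
  have [_ _ [e oK]] := pgroup_pdiv (abelem_pgroup (fin_ring_pchar_abelem cK)) (finNzRing_nontrivial K).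
  by rewrite /m -cardsT oK -expnM natrX pcharf0 // expr0n gtn_eqF // muln_gt0 n_gt0.
have Uzs : uniq zs.
  rewrite -separable_prod_XsubC -(eqp_separable DP) separable_poly.unlock.
  rewrite /P derivB derivXn derivX -mulr_natr -polyC_natr m0 mulr0 sub0r.
  by rewrite -[- 1]scaleN1r coprimepZr ?oppr_eq0 ?oner_eq0 // coprimep1.
(* [a] is the Frobenius map [z -> z^|K|], so the fixed field of [a^n] is the set of roots of
   [X^m - X]. *)
have [a _ Da] := finField_galois_generator (sub1v {:L}).
pose E := fixedSpace (a ^+ n)%g.
have in_zs : zs =i E.
  move=> z; rewrite -root_prod_XsubC -(eqp_root DP) (sameP fixedSpaceP eqP).
  rewrite /root !hornerE subr_eq0 /= /m; congr (_ == z).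
  elim: (n) => [|i IHi]; first by rewrite gal_id.
  by rewrite expgSr expnSr exprM IHi galM ?Da ?memvf // dimv1 expn1.
have defE : E = {:L}%VS.
  apply/eqP; rewrite eqEsubv subvf -defL -[E]subfield_closed agenvS //.
  by rewrite subv_add sub1v; apply/span_subvP => z; rewrite in_zs.
exists L; apply/eqP; rewrite -(@eqn_exp2l #|K|) ?finNzRing_gt1 //.
rewrite -/m -card_finvect_type.
have /eq_card-> : finvect_type L =i (zs : seq (finvect_type L)).
  by move=> z; rewrite in_zs defE memvf.
by rewrite (card_uniqP _) // -eqSS -(size_prod_XsubC _ id) -(eqp_size DP) sizeP.
Qed.

(* The exceptional set [irr] is the union of the proper subextensions of [L / K]. *)
Lemma field_matrix_rep_exists (K : finFieldType) (n : nat) : (0 < n)%N ->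
  exists (L : finFieldType) (io : {rmorphism K -> L}) (m : L -> 'M[K]_n)
    (irr : {set L}),
  [/\ #|L| = (#|K| ^ n)%N, m 1 = 1%:M, {morph m : x y / x + y},
     {morph m : x y / x * y >-> x *m y} & forall a, m (io a) = a%:M]
  /\ (#|irr| <= 2 * #|K| ^ n./2)%N
  /\ (forall s, s \notin irr -> forall l, exists u, l = (map_poly io u).[s]).
Proof.
move=> n_gt0; have [L dimL] := finField_ext_exists K n_gt0.
have Vdim : dim L = n by rewrite -dimL dimvf.
case: n / Vdim n_gt0 dimL => n_gt0 dimL.
pose F : finFieldType := FinFieldExtType L.
(* Multiplication by [l] in coordinates, acting on row vectors. *)
pose m (l : F) : 'M[K]_(dim L) :=
  lin1_mx (fun v : 'rV_(dim L) => v2r (r2v v * (l : L)) : 'rV_(dim L)).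
have mE l (v : 'rV_(dim L)) : v *m m l = v2r (r2v v * (l : L)).
  pose f (v : 'rV_(dim L)) : 'rV_(dim L) := v2r (r2v v * (l : L)).
  have fL : linear f.
    by move=> a u w; rewrite /f linearP mulrDl -scalerAl linearP.
  pose fM := GRing.isLinear.Build _ _ _ _ f fL.
  pose f' : {linear _ -> _} := HB.pack f fM.
  exact: (mul_rV_lin1 f').
pose io : {rmorphism K -> F} := in_alg L.
(* A proper subextension has degree [d <= n / 2] and its elements satisfy [s^(|K|^d) = s]; counting
   roots for each [d] gives a geometric sum. *)
pose irr := [set s : F | [exists d : 'I_((dim L)./2.+1), (0 < d)%N && (s ^+ (#|K| ^ d) == s)]].
exists F, io, m, irr; split; last split.
- split.
  + by rewrite card_finvect_type dimL.
  + by apply/row_matrixP => i; rewrite !rowE mE mulr1 r2vK mulmx1.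
  + by move=> x y; apply/row_matrixP => i; rewrite !rowE mulmxDr !mE mulrDr linearD.
  + by move=> x y; apply/row_matrixP => i; rewrite !rowE mulmxA !mE v2rK mulrA.
  + move=> a; apply/row_matrixP => i; rewrite !rowE mE mul_mx_scalar.
    by rewrite /io /= -scalerAr mulr1 linearZ /= r2vK.
- have q_gt1 := finNzRing_gt1 K.
  have le_irr : (#|irr| <= \sum_(d < (dim L)./2.+1 | (0 < d)%N) #|K| ^ d)%N.
    apply: leq_trans (_ : _ <= \sum_(d < (dim L)./2.+1 | (0 < d)%N)
       #|[set s : F | s ^+ (#|K| ^ d) == s]|)%N _.
      have -> : irr = \bigcup_(d < (dim L)./2.+1 | (0 < d)%N)
                        [set s : F | s ^+ (#|K| ^ d) == s].
        apply/setP => s; rewrite inE; apply/existsP/bigcupP.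
          by case=> d /andP[d0 sd]; exists d; rewrite ?inE.
        by case=> d d0; rewrite inE => sd; exists d; rewrite d0.
      elim/big_rec2: _ => [|d x A d0 le]; first by rewrite cards0.
      exact: leq_trans (leq_card_setU _ _) (leq_add _ _).
    apply: leq_sum => d d_gt0.
    pose P : {poly F} := 'X^(#|K| ^ d) - 'X.
    have sP : size P = (#|K| ^ d).+1.
      rewrite size_polyDl size_polyXn // size_polyN size_polyX.
      by rewrite ltnS -(prednK d_gt0) expnS (leq_trans q_gt1) ?leq_pmulr // expn_gt0 ltnW.
    rewrite -ltnS -sP cardE; apply: max_poly_roots; rewrite ?enum_uniq //.
      by rewrite -size_poly_gt0 sP.
    by apply/allP => s; rewrite mem_enum inE rootE !hornerE subr_eq0.
  apply: leq_trans le_irr _.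
  elim: (_./2) => [|e IH]; first by rewrite big_mkcond big_ord1.
  rewrite big_mkcond big_ord_recr -big_mkcond /=.
  apply: leq_trans (leq_add IH (leqnn _)) _.
  by rewrite expnS; move: (#|K|) (#|K| ^ e)%N q_gt1 => a b; nia.
move=> s s_reg l; have [defE|nE] := eqVneq <<1; s>>%VS {:L}%VS.
  have /Fadjoin_polyP[P P1 ->] : l \in <<1; s>>%VS by rewrite defE memvf.
  by have /polyOver1P[u ->] := P1; exists u.
case/negP: s_reg; rewrite inE.
pose E : {subfield L} := <<1; s>>%AS.
have dE : (\dim E < dim L)%N.
  rewrite -dimL ltn_neqAle dimvS ?subvf // andbT.
  by apply: contra_neq nE => dd; apply/eqP; rewrite eqEdim subvf dd leqnn.
have dvE : (\dim E %| dim L)%N by rewrite -dimL field_dimS // subvf.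
have leE : (\dim E <= (dim L)./2)%N.
  have /dvdnP[e eE] := dvE; rewrite eE.
  have e2 : (1 < e)%N by move: dE; rewrite eE; case: e {eE dvE} => [|[|e]] //; rewrite mul1n ltnn.
  by rewrite -divn2 leq_divRL // mulnC leq_mul2r e2 orbT.
apply/existsP; exists (Ordinal (leE : (\dim E < (dim L)./2.+1)%N)).
rewrite /= adim_gt0 -Fermat's_little_theorem.
exact: memv_adjoin.
Qed.

End FiniteFieldExtension.

(** * Action of the linear group on vectors *)

Definition GLset (K : finFieldType) (n : nat) : {set 'M[K]_n} :=
  [set X | X \in unitmx].

Section LinearGroup.
Variables (K : finFieldType) (n : nat).
Local Notation V := 'cV[K]_n.
Local Notation GL := (GLset K n).
Implicit Types (X Y : 'M[K]_n) (d e w z : V).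

Lemma GLset1 : 1%:M \in GL.
Proof. by rewrite inE unitmx1. Qed.

Lemma GLset_mul X Y : X \in GL -> Y \in GL -> X *m Y \in GL.
Proof. by rewrite !inE unitmx_mul => -> ->. Qed.

Lemma GLset_gt0 : (0 < #|GL|)%N.
Proof. by apply/card_gt0P; exists 1%:M; apply: GLset1. Qed.

Lemma GL_inj X : X \in GL -> injective (mulmx X : V -> V).
Proof. by rewrite inE => XU; apply: can_inj (mulKmx XU). Qed.

Lemma GL_neq0 X d : X \in GL -> d != 0 -> X *m d != 0.
Proof. by move=> XU; apply: contra_neq => Xd; apply: (GL_inj XU); rewrite mulmx0. Qed.

Lemma GL_transitive d w : d != 0 -> w != 0 -> exists2 X, X \in GL & X *m d = w.
Proof.
have rk (u : V) : u != 0 -> \rank u^T = 1%N.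
  move=> u0; apply/eqP; rewrite eqn_leq rank_leq_row lt0n mxrank_eq0.
  by apply: contra_neq u0 => uT; rewrite -[u]trmxK uT trmx0.
move=> d0 w0.
have dR : d^T *m pinvmx d^T = 1%:M.
  by apply: mulmxVp; rewrite /row_free rk.
have [| X XU E] := @complete_unitmx _ 1 n d^T (pinvmx d^T *m w^T).
  by rewrite mulmxA dR mul1mx !rk.
exists X^T; first by rewrite inE unitmx_tr.
by apply: trmx_inj; rewrite trmx_mul trmxK -E mulmxA dR mul1mx.
Qed.

(** Order of the stabilizer of [e]. By transitivity it serves for every nonzero vector: it counts
    the matrices that remain once a nonzero vector has a prescribed nonzero image. *)
Definition GLfix e := #|[set X in GL | X *m e == e]|.

(** Multiplying on both sides by matrices moving [e] to [d] and [w] to [e] carries the fiber into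
    the stabilizer of [e]; for [w = 0] the fiber is empty. *)
Lemma card_GL_fiber e d w : e != 0 -> d != 0 ->
  (#|[set X in GL | X *m d == w]| <= GLfix e)%N.
Proof.
move=> e0 d0; have [->|w0] := eqVneq w 0.
  rewrite (_ : [set X in GL | _] = set0) ?cards0 //; apply/setP => X.
  by rewrite !inE; apply/negP => /andP[XU]; apply/negP; apply: GL_neq0; rewrite ?inE.
have [P PU Pe] := GL_transitive e0 d0; have [Q QU Qw] := GL_transitive w0 e0.
apply: (@card_le_inj _ _ _ _ (fun X => Q *m X *m P)).
  move=> X; rewrite inE => /andP[XU /eqP Xd].
  by rewrite inE !GLset_mul // -!mulmxA Pe Xd Qw eqxx.
rewrite !inE in PU QU.
by move=> X Y _ _ /(can_inj (mulmxK PU)) /(can_inj (mulKmx QU)).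
Qed.

Lemma card_GLset e : e != 0 -> #|GL| = (GLfix e * (#|{: V}|.-1))%N.
Proof.
move=> e0; have -> : (#|{: V}|.-1) = #|[set w : V | w != 0]|.
  by rewrite (cardD1 0) inE /= cardsE; apply: eq_card => w; rewrite !inE andbT.
apply/eqP; rewrite eqn_leq; apply/andP; split.
  apply: (@card_le_fibers _ _ _ _ (fun X => X *m e)) => [X XU|w w0].
    by rewrite inE GL_neq0.
  exact: card_GL_fiber.
rewrite mulnC.
pose S := [set u : V * 'M[K]_n | (u.1 != 0) && (u.2 \in [set X in GL | X *m e == e])].
have -> : (#|[set w : V | w != 0%R]| * GLfix e)%N = #|S|.
  rewrite /GLfix -cardsX; apply: eq_card => u; rewrite !inE; reflexivity.
have /fin_all_exists[P HP] : forall w : V, exists X : 'M[K]_n, w != 0 -> X \in GL /\ X *m e = w.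
  move=> w; have [->|w0] := eqVneq w 0; first by exists 0.
  by have [X XU Xe] := GL_transitive e0 w0; exists X.
apply: (@card_le_inj _ _ _ _ (fun u : V * 'M[K]_n => P u.1 *m u.2)).
  move=> [w X]; rewrite inE /= => /andP[/HP[PU _]]; rewrite inE => /andP[XU _].
  exact: GLset_mul.
move=> [w X] [w' X'] /=; rewrite !inE /= => /andP[w0 /andP[XU /eqP Xe]] /andP[w'0 /andP[XU' /eqP Xe']] E.
have ww : w = w'.
  have /(congr1 (fun M => M *m e)) := E; rewrite /= -!mulmxA Xe Xe'.
  by have [_ ->] := HP _ w0; have [_ ->] := HP _ w'0.
move: E; rewrite -ww; have [] := HP _ w0; rewrite inE => PU _.
by move/(can_inj (mulKmx PU)) ->.
Qed.

End LinearGroup.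

(** * Self-correction *)

Section LocalTest.
Variables (K : finFieldType) (n : nat) (Z : zmodType).
Local Notation V := 'cV[K]_n.
Local Notation GL := (GLset K n).
Variable (D : {set V}).
Implicit Types (c f : V -> Z) (X A B : 'M[K]_n) (x z d e : V).

Definition test_sum c z X := \sum_(d in D) c (z + X *m d).
Definition punctured_sum c z X := \sum_(d in D :\ 0%R) c (z + X *m d).
(** Pairs are counted here rather than distinct supports; [rejE] shows that the proportion is the
    same. *)
Definition violated c : {set V * 'M[K]_n} :=
  [set u | (u.2 \in GL) && (test_sum c u.1 u.2 != 0)].

Hypothesis D0 : 0 \in D.

Lemma test_sumE c z X : test_sum c z X = c z + punctured_sum c z X.
Proof. by rewrite /test_sum (big_setD1 0) //= mulmx0 addr0. Qed.

(** If the tests at [(x + A d, B)] and [(x + B d, A)] hold for all nonzero [d] in [D], summing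
    [c (x + A d + B d')] over nonzero [d], [d'] by rows and by columns equates the punctured sums of
    [A] and [B]. A union bound over these tests remains, each violated pair being reached at most
    [GLfix e] times for a given [d]. *)
Lemma card_disagreement c x e : e != 0 ->
  (#|[set u : 'M[K]_n * 'M[K]_n | [&& u.1 \in GL, u.2 \in GL
       & punctured_sum c x u.1 != punctured_sum c x u.2]]|
   <= 2 * #|D :\ 0%R| * (GLfix e * #|violated c|))%N.
Proof.
move=> e0.
pose E1 d := [set u : 'M[K]_n * 'M[K]_n | [&& u.1 \in GL, u.2 \in GL
       & test_sum c (x + u.1 *m d) u.2 != 0]].
pose E2 d := [set u : 'M[K]_n * 'M[K]_n | [&& u.1 \in GL, u.2 \in GL
       & test_sum c (x + u.2 *m d) u.1 != 0]].
have cE1 d : d \in D :\ 0%R -> (#|E1 d| <= GLfix e * #|violated c|)%N.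
  rewrite !inE => /andP[d0 _].
  apply: (@card_le_fibers _ _ _ _ (fun u : 'M[K]_n * 'M[K]_n => (x + u.1 *m d, u.2))).
    by move=> [A B]; rewrite !inE /= => /and3P[_ -> ->].
  move=> [z B] _; apply: leq_trans (card_GL_fiber (z - x) e0 d0).
  apply: (@card_le_inj _ _ _ _ fst).
    move=> [A B']; rewrite inE => /andP[]; rewrite inE => /and3P[/= AU _ _].
    by rewrite inE AU xpair_eqE => /andP[/eqP<- _] /=; rewrite addrC addKr eqxx.
  move=> [A B1] [A' B2]; rewrite !inE /= !xpair_eqE.
  by move=> /andP[_ /andP[_ /eqP->]] /andP[_ /andP[_ /eqP->]] ->.
have cE2 d : d \in D :\ 0%R -> (#|E2 d| <= GLfix e * #|violated c|)%N.
  move=> Dd; apply: leq_trans (cE1 d Dd).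
  apply: (@card_le_inj _ _ _ _ (fun u : 'M[K]_n * 'M[K]_n => (u.2, u.1))).
    by move=> [A B]; rewrite !inE /= => /and3P[-> -> ->].
  by move=> [A B] [A' B'] _ _ /= [-> ->].
apply: leq_trans (_ : _ <= #|\bigcup_(d in D :\ 0%R) E1 d :|: \bigcup_(d in D :\ 0%R) E2 d|)%N _.
  apply/subset_leq_card/subsetP => -[A B]; rewrite inE /= => /and3P[AU BU].
  apply: contraNT; rewrite inE negb_or => /andP[/bigcupP nE1 /bigcupP nE2].
  have t1 d : d \in D :\ 0%R -> test_sum c (x + A *m d) B = 0.
    move=> Dd; apply/eqP/negPn/negP => nz; case: nE1; exists d => //.
    by rewrite !inE in AU BU *; rewrite /= AU BU.
  have t2 d : d \in D :\ 0%R -> test_sum c (x + B *m d) A = 0.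
    move=> Dd; apply/eqP/negPn/negP => nz; case: nE2; exists d => //.
    by rewrite !inE in AU BU *; rewrite /= AU BU.
  pose s := \sum_(d in D :\ 0%R) \sum_(d' in D :\ 0%R) c (x + A *m d + B *m d').
  apply/eqP; apply: (@addIr _ s); transitivity (0 : Z).
    rewrite /punctured_sum /s -big_split /=; apply: big1 => d Dd.
    by have := t1 d Dd; rewrite test_sumE.
  apply/esym; rewrite /s exchange_big /punctured_sum -big_split /=; apply: big1 => d Dd.
  have := t2 d Dd; rewrite test_sumE => t2d; rewrite -[RHS]t2d; congr (_ + _).
  by apply: eq_bigr => d' _; rewrite addrAC.
apply: leq_trans (leq_card_setU _ _) _.
apply: leq_trans (leq_add (card_bigcup_le cE1) (card_bigcup_le cE2)) _.
by rewrite addnn -mul2n mulnA.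
Qed.

Definition miscorrected c f x := [set A in GL | punctured_sum c x A != - f x].

(** The correction at [x] is the vote of a matrix [B] with fewest disagreeing partners; this minimum
    is at most the average, which [card_disagreement] bounds. *)
Lemma correction_exists c e : e != 0 -> exists f : V -> Z, forall x,
  (#|GL| * #|miscorrected c f x| <= 2 * #|D :\ 0%R| * (GLfix e * #|violated c|))%N.
Proof.
move=> e0.
have /fin_all_exists[f Hf] : forall x, exists y : Z,
    (#|GL| * #|[set A in GL | punctured_sum c x A != - y]| <= 2 * #|D :\ 0%R| * (GLfix e * #|violated c|))%N.
  move=> x; pose w B := #|[set A in GL | punctured_sum c x A != punctured_sum c x B]|.
  have := GLset1 K n; case/(arg_minnP w) => B BU minB.
  exists (- punctured_sum c x B); rewrite opprK -/(w B).
  apply: leq_trans (card_disagreement c x e0).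
  have -> : #|[set u : 'M[K]_n * 'M[K]_n | [&& u.1 \in GL, u.2 \in GL
       & punctured_sum c x u.1 != punctured_sum c x u.2]]| = (\sum_(B' in GL) w B')%N.
    rewrite (card_pair_sumr (fun A B' => [&& A \in GL, B' \in GL
      & punctured_sum c x A != punctured_sum c x B'])) [RHS]big_mkcond /=.
    apply: eq_bigr => B' _; case: ifP => B'U.
      by apply: eq_card => A; rewrite !inE.
    by apply/eqP; rewrite cards_eq0; apply/eqP/setP => A; rewrite !inE andbF.
  by rewrite -sum_nat_const; apply: leq_sum => B'; apply: minB.
by exists f.
Qed.

(** Where [c x] differs from [f x], every [A] outside [miscorrected] has test sum [c x - f x], so
    its test is violated. *)
Lemma card_corrected c f (b : nat) :
  (forall x, #|miscorrected c f x| <= b)%N ->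
  (#|[set x | c x != f x]| * (#|GL| - b) <= #|violated c|)%N.
Proof.
move=> Hb.
apply: leq_trans (_ : _ <= \sum_(x in [set x | c x != f x]) #|[set A in GL | test_sum c x A != 0%R]|)%N _.
  rewrite -sum_nat_const; apply: leq_sum => x; rewrite inE => nx.
  rewrite leq_subLR; apply: leq_trans (_ : #|miscorrected c f x :|: [set A in GL | test_sum c x A != 0%R]| <= _)%N.
    apply/subset_leq_card/subsetP => A; rewrite !inE => -> /=.
    apply: contraR nx; rewrite negb_or !negbK test_sumE => /andP[/eqP->].
    by rewrite subr_eq0.
  exact: leq_trans (leq_card_setU _ _) (leq_add (Hb x) _).
rewrite [leqRHS](card_pair_suml (fun x A => (A \in GL) && (test_sum c x A != 0))).
by rewrite [leqLHS]big_mkcond /=; apply: leq_sum => x _; case: ifP.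
Qed.

(** A second moment count. A test meeting [S] exactly once is violated, since its sums for [c] and
    [f] differ in a single term; tests meeting [S] more often are charged to pairs of points of
    [S]. *)
Lemma violated_amplified c f e (S := [set x | c x != f x]) : e != 0 ->
  {in GL, forall X z, test_sum f z X = 0} ->
  (#|D| * (#|S| * #|GL|) <= #|violated c| + #|D| * #|D| * (GLfix e * (#|S| * #|S|)))%N.
Proof.
move=> e0 fC.
pose O : {set V * 'M[K]_n} := setX setT GL.
pose hit d : {set V * 'M[K]_n} := [set u in O | u.1 + u.2 *m d \in S].
pose hits (u : V * 'M[K]_n) := #|[set d in D | u.1 + u.2 *m d \in S]|.
have chit d : (#|S| * #|GL| <= #|hit d|)%N.
  rewrite -cardsX; apply: (@card_le_inj _ _ _ _ (fun u : V * 'M[K]_n => (u.1 - u.2 *m d, u.2))).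
    by move=> [z X]; rewrite !inE /= subrK => /andP[-> ->].
  by move=> [z X] [z' X'] _ _ /= [E EX]; move: E; rewrite EX => /addIr ->.
(* Prescribing the images of [d] and [d'] prescribes [X (d' - d)], and then [z]. *)
have cpair d d' : d != d' -> (#|hit d :&: hit d'| <= GLfix e * (#|S| * #|S|))%N.
  move=> dd; rewrite -cardsX.
  apply: (@card_le_fibers _ _ _ _ (fun u : V * 'M[K]_n => (u.1 + u.2 *m d, u.1 + u.2 *m d'))).
    by move=> [z X]; rewrite !inE /= => /andP[/andP[_ ->] /andP[_ ->]].
  move=> [a b] _; apply: leq_trans (card_GL_fiber (b - a) e0 (_ : d' - d != 0)); last first.
    by rewrite subr_eq0 eq_sym.
  apply: (@card_le_inj _ _ _ _ snd).
    move=> [z X]; rewrite !inE /= xpair_eqE => /andP[/andP[/andP[XU _] _] /andP[/eqP<- /eqP<-]].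
    by rewrite XU mulmxBr opprD addrACA subrr add0r eqxx.
  move=> [z X] [z' X']; rewrite !inE /= !xpair_eqE.
  move=> /andP[_ /andP[/eqP<- _]] /andP[_ /andP[/eqP E _]] XX.
  by move: E; rewrite XX => /addIr ->.
have sum_hits : (\sum_(u in O) hits u = \sum_(d in D) #|hit d|)%N.
  transitivity (\sum_(u in O) \sum_(d in D | (u.1 + u.2 *m d)%R \in S) 1)%N.
    by apply: eq_bigr => u _; rewrite sum1dep_card.
  rewrite (exchange_big_dep (mem D)) => [|u d _ /andP[]] //=.
  by apply: eq_bigr => d Dd; rewrite sum1dep_card; apply: eq_card => u; rewrite !inE Dd.
have sum_pairs : (\sum_(u in O) hits u * (hits u).-1 =
    \sum_(d in D) \sum_(d' in D :\ d) #|hit d :&: hit d'|)%N.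
  transitivity (\sum_(u in O) \sum_(d in D | (u.1 + u.2 *m d)%R \in S) \sum_(d' in D :\ d | (u.1 + u.2 *m d')%R \in S) 1)%N.
    apply: eq_bigr => u _.
    transitivity (\sum_(d in D | (u.1 + u.2 *m d)%R \in S) (hits u).-1)%N.
      by rewrite sum_nat_cond_const.
    apply: eq_bigr => d /andP[Dd Sd]; rewrite sum1dep_card /hits (cardsD1 d) inE Dd Sd.
    by apply: eq_card => d'; rewrite !inE andbA.
  rewrite (exchange_big_dep (mem D)) => [|u d _ /andP[]] //=.
  apply: eq_bigr => d Dd.
  rewrite (exchange_big_dep (mem (D :\ d))) => [|u d' _ /andP[]] //=.
  apply: eq_bigr => d' Dd'; rewrite sum1dep_card; apply: eq_card => u; rewrite !inE.
  by move: Dd'; rewrite !inE => ->; rewrite Dd /=; case: (u.2 \in unitmx).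
(* This is [j <= [j = 1] + j (j - 1)]. *)
have pointwise u : u \in O -> (hits u <= (u \in violated c) + hits u * (hits u).-1)%N.
  rewrite inE => /andP[_ UX].
  case E : (hits u) => [|[|j]] //; last by rewrite /=; lia.
  suff -> : u \in violated c by [].
  rewrite inE UX /=; move/eqP: E; rewrite /hits => /cards1P[d0 Ed].
  have : d0 \in [set d in D | u.1 + u.2 *m d \in S] by rewrite Ed set11.
  rewrite !inE => /andP[Dd0 Sd0].
  rewrite -subr_eq0 in Sd0; apply: contraNneq Sd0 => tc.
  have := fC _ UX u.1; move/(congr1 (fun y => test_sum c u.1 u.2 - y)).
  rewrite subr0 tc -tc -{1}sumrB (bigD1 d0) //= big1 => [|d /andP[Dd ndd]].
    by rewrite addr0 => ->.
  apply/eqP; rewrite subr_eq0; apply: contraR ndd => Sd.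
  by rewrite -in_set1 -Ed !inE Dd.
have le1 : (\sum_(u in O) hits u <= #|violated c| + \sum_(u in O) hits u * (hits u).-1)%N.
  apply: leq_trans (leq_sum _ pointwise) _; rewrite big_split leq_add2r.
  by rewrite -sum1_card big_mkcond [leqRHS]big_mkcond; apply: leq_sum => u _; case: (u \in O); case: (u \in violated c).
apply: leq_trans (_ : _ <= \sum_(d in D) #|hit d|)%N _.
  by rewrite -sum_nat_const; apply: leq_sum.
rewrite -sum_hits; apply: leq_trans le1 _; rewrite leq_add2l sum_pairs.
rewrite -mulnA -sum_nat_const; apply: leq_sum => d Dd.
apply: leq_trans (_ : _ <= \sum_(d' in D :\ d) (GLfix e * (#|S| * #|S|)))%N _.
  by apply: leq_sum => d'; rewrite !inE => /andP[nd _]; apply: cpair; rewrite eq_sym.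
by rewrite sum_nat_const leq_mul2r subset_leq_card ?orbT // subsetDl.
Qed.

End LocalTest.

(** * The corrected word lies in the code *)

Section FieldAction.
Variables (K : finFieldType) (n : nat) (L : finFieldType).
Variables (io : {rmorphism K -> L}) (m : L -> 'M[K]_n).
Hypotheses (n_gt0 : (0 < n)%N) (cardL : #|L| = (#|K| ^ n)%N).
Hypotheses (m1 : m 1 = 1%:M) (mD : {morph m : x y / x + y}).
Hypothesis (mM : {morph m : x y / x * y >-> x *m y}).
Hypothesis (mio : forall a, m (io a) = a%:M).
Variable (e : 'cV[K]_n).
Hypothesis (e0 : e != 0).
Local Notation V := 'cV[K]_n.
Local Notation GL := (GLset K n).

Lemma fieldrep0 : m 0 = 0.
Proof. by apply: (@addrI _ (m 0)); rewrite -mD !addr0. Qed.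

Lemma fieldrep_GL l : l != 0 -> m l \in GL.
Proof.
move=> l0; rewrite inE; have : m l *m m l^-1 = 1%:M by rewrite -mM divff.
by case/mulmx1_unit.
Qed.

(** Identifies [L] with [V] through the orbit of [e], so that the matrix [m l] becomes
    multiplication by [l]; the inverse is [coord_of]. *)
Definition vec_of l : V := m l *m e.

Lemma vec_of_inj : injective vec_of.
Proof.
move=> a b E; apply/eqP; rewrite -subr_eq0; apply/negPn/negP => ab.
have mB : m (a - b) *m e = 0.
  have : m (a - b + b) *m e = m b *m e by rewrite subrK.
  by rewrite mD mulmxDl -[RHS]add0r => /addIr.
by have := GL_neq0 (fieldrep_GL ab) e0; rewrite mB eqxx.
Qed.

Lemma vec_of_bij : bijective vec_of.
Proof. by apply: inj_card_bij vec_of_inj _; rewrite card_mx muln1 cardL. Qed.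

Definition coord_of (w : V) : L := odflt 0 [pick l | vec_of l == w].

Lemma coord_ofK w : vec_of (coord_of w) = w.
Proof.
rewrite /coord_of; case: pickP => [l /eqP //|no].
by have [g _ /(_ w) gK] := vec_of_bij; have := no (g w); rewrite gK eqxx.
Qed.

Lemma coord_of_neq0 w : w != 0 -> coord_of w != 0.
Proof.
apply: contra_neq => cw; rewrite -(coord_ofK w) cw /vec_of fieldrep0.
exact: mul0mx.
Qed.

Lemma fieldrep_act l w : m l *m w = vec_of (l * coord_of w).
Proof. by rewrite /vec_of mM -mulmxA -/(vec_of _) coord_ofK. Qed.

Lemma vec_ofD a b : vec_of (a + b) = vec_of a + vec_of b.
Proof. by rewrite /vec_of mD mulmxDl. Qed.

(** [m s] and [X] are similar, so by Cayley-Hamilton the value at [s] of the characteristic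
    polynomial acts as zero, whereas nonzero elements of [L] act invertibly. *)
Lemma intertwined_root (s : L) (Q X : 'M[K]_n) : Q \in GL -> m s *m Q = Q *m X ->
  root (map_poly io (char_poly X)) s.
Proof.
(* Evaluating polynomials at matrices requires a size of successor form. *)
case: n n_gt0 m m1 mD mM mio Q X => // n' _ mm mm1 mmD mmM mmio Q X.
rewrite inE => QU E.
have mm0 : mm 0 = 0 by apply: (@addrI _ (mm 0)); rewrite -mmD !addr0.
have horn (P : {poly K}) : mm (map_poly io P).[s] *m Q = Q *m horner_mx X P.
  elim/poly_ind: P => [|P a IH].
    by rewrite rmorph0 horner0 mm0 mul0mx rmorph0 mulmx0.
  rewrite rmorphD rmorphM /= map_polyX map_polyC /= hornerD hornerM hornerX hornerC.
  rewrite mmD mmM mmio mulmxDl -mulmxA E mulmxA IH.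
  rewrite rmorphD rmorphM /= horner_mx_X horner_mx_C mulmxDr mulmxA.
  by congr (_ + _); rewrite scalar_mxC.
have := horn (char_poly X); rewrite Cayley_Hamilton mulmx0 => H.
apply/negPn/negP => nz; have : mm (map_poly io (char_poly X)).[s] *m mm (map_poly io (char_poly X)).[s]^-1 = 1%:M.
  by rewrite -mmM divff.
case/mulmx1_unit => U _; move/eqP: H; rewrite -(mul0mx _ Q).
move/eqP/(can_inj (mulmxK QU)) => Z0.
by move: U; rewrite Z0 unitmxE det0 unitr0.
Qed.

(** * Conjugates of generic field elements *)

Variable irr : {set L}.
Hypothesis reg : forall s, s \notin irr -> forall l, exists u, l = (map_poly io u).[s].

Lemma centralizer_regular s (Y : 'M[K]_n) : s \notin irr -> m s *m Y = Y *m m s ->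
  forall l, m l *m Y = Y *m m l.
Proof.
move=> sR cY l; have [u ->] := reg sR l.
elim/poly_ind: u => [|P a IH].
  by rewrite rmorph0 horner0 fieldrep0 mul0mx mulmx0.
rewrite rmorphD rmorphM /= map_polyX map_polyC /= hornerD hornerM hornerX hornerC.
by rewrite mD mM mio mulmxDl -mulmxA cY mulmxA IH mulmxDr mulmxA scalar_mxC.
Qed.

(** [s] is one of at most [n] roots of the characteristic polynomial of [X]. For fixed [s], two
    conjugators differ by a matrix commuting with [m s], hence with all of [L]; it is determined by
    its value at [e], which leaves [|L|] choices. *)
Lemma card_regular_conjugators (X : 'M[K]_n) :
  (#|[set u : 'M[K]_n * L | [&& u.1 \in GL, u.2 \notin irr
        & invmx u.1 *m m u.2 *m u.1 == X]]| <= #|L| * n)%N.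
Proof.
set S := [set u | _]; pose R := [set s | root (map_poly io (char_poly X)) s].
have mQ u : u \in S -> m u.2 *m u.1 = u.1 *m X.
  case: u => Q s; rewrite !inE /= => /and3P[QU _ /eqP<-].
  by rewrite !mulmxA mulmxV // mul1mx.
apply: leq_trans (_ : #|L| * #|R| <= _)%N; last first.
  rewrite leq_mul2l; apply/orP; right.
  have sP : size (map_poly io (char_poly X)) = n.+1 by rewrite size_map_poly size_char_poly.
  rewrite -ltnS -sP cardE; apply: max_poly_roots; rewrite ?enum_uniq //.
    by rewrite -size_poly_gt0 sP.
  by apply/allP => s; rewrite mem_enum inE.
apply: (@card_le_fibers _ _ _ _ snd) => [u uS|s _].
  have QU : u.1 \in GL by move: uS; rewrite inE => /and3P[].
  by rewrite inE; apply: intertwined_root QU (mQ u uS).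
set F := [set u in S | _].
have [->|[u0 u0F]] := set_0Vmem F; first by rewrite cards0.
have inF u : u \in F -> [/\ u.1 \in GL, s \notin irr, u.2 = s & m s *m u.1 = u.1 *m X].
  rewrite inE => /andP[uS /eqP <-]; split=> //; last exact: mQ.
    by move: uS; rewrite inE => /and3P[].
  by move: uS; rewrite inE => /and3P[].
have [Q0U _ _ E0] := inF _ u0F; set Q0 := u0.1 in Q0U E0.
rewrite cardL -[n in leqRHS]muln1 -card_mx -cardsT.
apply: (@card_le_inj _ _ _ _ (fun u : 'M[K]_n * L => u.1 *m invmx Q0 *m e)) => [u _|u u' uF u'F].
  exact: in_setT.
have [QU sR u2 E] := inF _ uF; have [Q'U _ u'2 E'] := inF _ u'F.
rewrite inE in Q0U.
have XE : X = invmx Q0 *m m s *m Q0 by rewrite -mulmxA E0 mulKmx.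
have comm Q : m s *m Q = Q *m X -> m s *m (Q *m invmx Q0) = (Q *m invmx Q0) *m m s.
  by move=> EQ; rewrite mulmxA EQ XE !mulmxA mulmxK.
have cent Q : m s *m Q = Q *m X -> forall w, Q *m invmx Q0 *m w = m (coord_of w) *m (Q *m invmx Q0 *m e).
  move=> EQ w; rewrite [RHS]mulmxA (centralizer_regular sR (comm Q EQ)) -[RHS]mulmxA.
  by rewrite -/(vec_of _) coord_ofK.
move=> Ee; have : u.1 *m invmx Q0 = u'.1 *m invmx Q0.
  apply/matrixP => i j.
  have : u.1 *m invmx Q0 *m delta_mx j 0 = u'.1 *m invmx Q0 *m (delta_mx j 0 : V).
    by rewrite (cent _ E) (cent _ E') Ee.
  by rewrite -!colE => /matrixP/(_ i 0); rewrite !mxE.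
move/(can_inj (mulmxKV Q0U)) => uu.
by rewrite [u]surjective_pairing [u']surjective_pairing uu u2 u'2.
Qed.

(** * Arrays twisted by the field multiplication, and the case of small dimension *)

Variables (Z : zmodType) (D : {set V}) (c f : V -> Z) (b : nat).
Hypothesis D0 : 0 \in D.
Hypothesis miscorrected_le : forall x, (#|miscorrected D c f x| <= b)%N.

(** Row [d] of [M] expresses [f (x + A d)] as minus the sum of its entries with [d' <> 0];
    exchanging summations leaves the columns [d' <> 0], whose sums vanish. *)
Lemma corrected_test_sum x (A : 'M[K]_n) (M : V -> V -> V) :
  (forall d, d \in D -> exists2 B, punctured_sum D c (x + A *m d) B = - f (x + A *m d)
     & {in D, forall d', M d d' = x + A *m d + B *m d'}) ->
  (forall d', d' \in D :\ 0 -> exists z, exists2 X, test_sum D c z X = 0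
     & {in D, forall d, M d d' = z + X *m d}) ->
  test_sum D f x A = 0.
Proof.
move=> rows cols; rewrite /test_sum -[LHS]opprK -sumrN.
rewrite (eq_bigr (fun d => \sum_(d' in D :\ 0) c (M d d'))) => [|d Dd].
  rewrite exchange_big big1 ?oppr0 //= => d' /cols[z [X t0 E]].
  by rewrite -[RHS]t0 /test_sum; apply: eq_bigr => d Dd; rewrite E.
have [B <- E] := rows d Dd.
by apply: eq_bigr => d'; rewrite inE => /andP[_ Dd']; rewrite E.
Qed.

(** For random [Q], [P] in [GL] and [beta], [t] in [L], writing [[v]] for [coord_of v], the array is
    [x + A Q^-1 vec_of ([Q d] + beta [P d'] + t [Q d] [P d'])]. Row [d] has multiplier [beta + t
    [Q d]] and column [d'] has [1 + t [P d']]. The assumed inequality is a union bound over bad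
    events. *)
Lemma corrected_in_code_small_dim x (A : 'M[K]_n) : 0 \in irr -> A \in GL ->
  (#|D| * #|GL| + #|D| * (#|L| * b)
    + #|D| * (#|GL| * #|irr| + n * #|violated D c|) < #|GL| * #|L|)%N ->
  test_sum D f x A = 0.
Proof.
move=> irr0 AU Hlt.
pose T := (('M[K]_n * 'M[K]_n) * (L * L))%type.
pose Om : {set T} := setX (setX GL GL) setT.
pose rowc (w : T) d := w.2.1 + w.2.2 * coord_of (w.1.1 *m d).
pose rowm (w : T) d := A *m invmx w.1.1 *m m (rowc w d) *m w.1.2.
pose colc (w : T) d := 1 + w.2.2 * coord_of (w.1.2 *m d).
pose colm (w : T) d := A *m invmx w.1.1 *m m (colc w d) *m w.1.1.
pose colz (w : T) d := x + A *m invmx w.1.1 *m vec_of (w.2.1 * coord_of (w.1.2 *m d)).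
(* [E0]: the row multiplier vanishes, which fixes [beta]. [E1]: the row matrix, uniform through [P],
   is miscorrected. [E2]: the column multiplier is exceptional, which restricts [t]. [E3]: the
   multiplier is generic but the column test is violated. *)
pose E0 d := [set w in Om | rowc w d == 0].
pose E1 d := [set w in Om | (rowc w d != 0) && (rowm w d \in miscorrected D c f (x + A *m d))].
pose E2 d := [set w in Om | colc w d \in irr].
pose E3 d := [set w in Om | (colc w d \notin irr) && ((colz w d, colm w d) \in violated D c)].
have cardOm : #|Om| = (#|GL| * #|GL| * (#|L| * #|L|))%N.
  by rewrite !cardsX cardsT card_prod.
have OmE w : (w \in Om) = (w.1.1 \in GL) && (w.1.2 \in GL).
  by case: w => [[Q P] bt]; rewrite !in_setX in_setT andbT.
have c0 d : (#|E0 d| <= #|GL| * #|GL| * #|L|)%N.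
  rewrite -cardsX -[#|L|]cardsT -cardsX.
  apply: (@card_le_inj _ _ _ _ (fun w : T => (w.1, w.2.2))).
    by move=> [[Q P] [be t]]; rewrite !inE /= => /andP[/andP[->]].
  move=> [[Q P] [be t]] [[Q' P'] [be' t']]; rewrite !inE /= /rowc /=.
  move=> /andP[_ /eqP H1] /andP[_ /eqP H2] [EQ EP Et]; move: H2; rewrite -EQ -EP -Et -H1.
  by move/addIr ->.
have c1 d : (#|E1 d| <= b * (#|GL| * (#|L| * #|L|)))%N.
  rewrite -card_prod -[#|{: L * L}|]cardsT -cardsX.
  apply: (@card_le_fibers _ _ _ _ (fun w : T => (w.1.1, w.2))).
    by move=> [[Q P] [be t]]; rewrite !inE /= => /andP[/andP[/andP[->]]].
  move=> [Q0 bt0] _; apply: leq_trans (miscorrected_le (x + A *m d)).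
  apply: (@card_le_inj _ _ _ _ (fun w : T => rowm w d)).
    by move=> w /setIdP[/setIdP[_ /andP[_ ->]]].
  move=> [[Q P] bt] [[Q' P'] bt']; rewrite !inE /= !xpair_eqE /rowm /rowc /=.
  move=> /andP[/andP[/andP[/andP[QU _] _] /andP[rc _]] /andP[/eqP EQ /eqP Ebt]].
  move=> /andP[_ /andP[/eqP EQ' /eqP Ebt']].
  subst Q bt Q' bt'.
  have := fieldrep_GL rc; rewrite !inE in AU * => mU.
  have U : A *m invmx Q0 *m m (bt0.1 + bt0.2 * coord_of (Q0 *m d)) \in unitmx.
    by rewrite !unitmx_mul AU unitmx_inv QU mU.
  by move/(can_inj (mulKmx U)) ->.
have colb w d : w \in Om -> d \in D :\ 0 -> coord_of (w.1.2 *m d) != 0.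
  move=> wO; rewrite !inE => /andP[d0 _]; apply/coord_of_neq0/GL_neq0 => //.
  by move: wO; rewrite !inE => /andP[/andP[_ ->]].
have c2 d : d \in D :\ 0 -> (#|E2 d| <= #|GL| * #|GL| * (#|L| * #|irr|))%N.
  move=> Dd; rewrite -[#|L|]cardsT -cardsX -[(#|[set: L]| * _)%N]cardsX -cardsX.
  apply: (@card_le_inj _ _ _ _ (fun w : T => (w.1, (w.2.1, colc w d)))).
    by move=> [[Q P] [be t]] /setIdP[]; rewrite OmE !in_setX in_setT /= => -> ->.
  move=> w w' /setIdP[wO _] _.
  have := colb w d wO Dd; case: w w' wO => [[Q P] [be t]] [[Q' P'] [be' t']] _ /=.
  rewrite /colc /= => bn [EQ EP Eb].
  by rewrite -EP => /addrI /(mulIf bn) ->; rewrite EQ Eb.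
have c3 d : d \in D :\ 0 -> (#|E3 d| <= #|L| * n * (#|GL| * #|violated D c|))%N.
  move=> Dd; rewrite -[(#|GL| * _)%N]cardsX.
  apply: (@card_le_fibers _ _ _ _ (fun w : T => (w.1.2, (colz w d, colm w d)))).
    by move=> w /setIdP[]; rewrite OmE in_setX => /andP[_ ->] /andP[_ ->].
  move=> [P0 [z0 X0]] _.
  (* Given [P], the column matrix leaves at most [|L| n] pairs of [Q] and multiplier; the multiplier
     gives [t], and the base point then gives [beta]. *)
  apply: leq_trans (card_regular_conjugators (invmx A *m X0)).
  apply: (@card_le_inj _ _ _ _ (fun w : T => (w.1.1, colc w d))).
    move=> w /setIdP[/setIdP[]]; rewrite OmE => /andP[QU _] /andP[reg_w _] /eqP[_ _ <-].
    rewrite inE QU reg_w /=.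
    by rewrite inE in AU; rewrite /colm -!mulmxA mulKmx // eqxx.
  move=> w w' /setIdP[/setIdP[wO _] /eqP[EP Ez _]] /setIdP[/setIdP[wO' _] /eqP[EP' Ez' _]].
  have := colb w d wO Dd; rewrite EP => bn [EQ].
  move: Ez' (Ez'); rewrite -{1}Ez /colz /colc EP EP' EQ => /addrI Ev _.
  move=> /addrI /(mulIf bn) Et.
  have QU : A *m invmx w'.1.1 \in unitmx.
    move: wO'; rewrite !inE => /andP[/andP[QU _] _].
    by rewrite inE in AU; rewrite unitmx_mul AU unitmx_inv.
  move: Ev => /(can_inj (mulKmx QU)) /vec_of_inj /(mulIf bn) Eb.
  clear -EP EP' EQ Et Eb.
  case: w w' EP EP' EQ Et Eb => [[Q P] [be t]] [[Q' P'] [be' t']] /=.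
  by move=> -> -> -> -> ->.
pose U := (\bigcup_(d in D) E0 d) :|: (\bigcup_(d in D) E1 d)
   :|: ((\bigcup_(d in D :\ 0) E2 d) :|: (\bigcup_(d in D :\ 0) E3 d)).
have leD : (#|D :\ 0%R| <= #|D|)%N by rewrite subset_leq_card ?subsetDl.
have ltU : (#|U| < #|Om|)%N.
  apply: leq_ltn_trans (leq_card_setU _ _) _.
  apply: leq_ltn_trans (leq_add (leq_card_setU _ _) (leq_card_setU _ _)) _.
  have b0 := card_bigcup_le (D := D) (fun d _ => c0 d).
  have b1 := card_bigcup_le (D := D) (fun d _ => c1 d).
  have b2 := card_bigcup_le c2; have b3 := card_bigcup_le c3.
  apply: leq_ltn_trans (leq_add (leq_add b0 b1) (leq_add b2 b3)) _.
  rewrite cardOm.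
  have gN : (0 < #|GL| * #|L|)%N.
    by rewrite muln_gt0 GLset_gt0; apply/card_gt0P; exists 0.
  apply: leq_ltn_trans (_ : _ <= #|GL| * #|L| * (#|D| * #|GL| + #|D| * (#|L| * b)
    + #|D| * (#|GL| * #|irr| + n * #|violated D c|)))%N _.
    apply: leq_trans (leq_add (leqnn _) (leq_add (leq_mul leD (leqnn _)) (leq_mul leD (leqnn _)))) _.
    by apply/eq_leq; ring.
  by rewrite mulnACA ltn_pmul2l // .
have [w wO wU] : exists2 w, w \in Om & w \notin U.
  have /subsetPn[w ? ?] : ~~ (Om \subset U).
    by apply/negP => /subset_leq_card; rewrite leqNgt ltU.
  by exists w.
have QU : w.1.1 \in unitmx by move: wO; rewrite !inE => /andP[/andP[->]].
have PU : w.1.2 \in unitmx by move: wO; rewrite !inE => /andP[/andP[_ ->]].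
have AQ d : A *m invmx w.1.1 *m vec_of (coord_of (w.1.1 *m d)) = A *m d.
  by rewrite coord_ofK -mulmxA mulKmx.
move: wU; rewrite !inE !negb_or => /andP[/andP[/bigcupP n0 /bigcupP n1] /andP[/bigcupP n2 /bigcupP n3]].
pose M d d' := x + A *m invmx w.1.1 *m vec_of (coord_of (w.1.1 *m d)
   + w.2.1 * coord_of (w.1.2 *m d') + w.2.2 * coord_of (w.1.1 *m d) * coord_of (w.1.2 *m d')).
apply: (@corrected_test_sum x A M) => [d Dd|d' Dd'].
  have rw0 : rowc w d != 0.
    by apply/negP => r0; apply: n0; exists d => //; rewrite inE wO.
  have BU : rowm w d \in GL.
    have := fieldrep_GL rw0; rewrite !inE => mU.
    by rewrite !unitmx_mul mU PU unitmx_inv QU; move: AU; rewrite inE => ->.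
  exists (rowm w d).
    apply/eqP/negPn/negP => bad; apply: n1; exists d => //.
    by rewrite inE wO rw0 inE BU.
  move=> d' _; rewrite /M -addrA vec_ofD mulmxDr AQ addrA; congr (_ + _).
  have -> : rowm w d *m d' = A *m invmx w.1.1 *m (m (rowc w d) *m (w.1.2 *m d')).
    by rewrite /rowm !mulmxA.
  by rewrite fieldrep_act /rowc mulrDl.
have reg_w : colc w d' \notin irr.
  by apply/negP => ri; apply: n2; exists d' => //; rewrite inE wO.
have cU : colm w d' \in GL.
  have c_0 : colc w d' != 0 by apply: contraNneq reg_w => ->.
  have := fieldrep_GL c_0; rewrite !inE => mU.
  by rewrite !unitmx_mul mU QU unitmx_inv QU; move: AU; rewrite inE => ->.
exists (colz w d'), (colm w d').
  apply/eqP/negPn/negP => bad; apply: n3; exists d' => //.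
  by rewrite inE wO reg_w inE cU.
move=> d _; have -> : colm w d' *m d = A *m invmx w.1.1 *m (m (colc w d') *m (w.1.1 *m d)).
  by rewrite /colm !mulmxA.
rewrite /M /colz -[RHS]addrA fieldrep_act -mulmxDr -vec_ofD; congr (_ + _ *m vec_of _).
by rewrite /colc; ring.
Qed.

(** * Uniform matrices, and the case of large dimension *)

Let row_count (g N E P mu ne q bx : nat) : (E <= P * mu)%N ->
  (g * P <= g * ne + bx * mu)%N -> (bx <= b)%N -> (N * ne <= q * mu)%N ->
  (g * N * E <= mu * mu * (N * b + g * q))%N.
Proof.
move=> le1 le2 le3 le4.
apply: leq_trans (leq_mul (leqnn _) le1) _.
rewrite (_ : g * N * (P * mu) = N * mu * (g * P))%N; last by ring.
apply: leq_trans (leq_mul (leqnn _) le2) _.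
rewrite (_ : N * mu * _ = mu * (g * (N * ne)) + mu * mu * (N * bx))%N; last by ring.
rewrite (_ : mu * mu * (N * b + g * q) = mu * (g * (q * mu)) + mu * mu * (N * b))%N; last by ring.
by apply: leq_add => //; apply: leq_mul => //; apply: leq_mul.
Qed.

(** With denominators cleared, [E / mu^2 <= v / (g N) + q / N]; the row version has [b / g] in place
    of [v / (g N)]. *)
Let col_count (g N E a t mu ne v q : nat) : (E <= a * t)%N -> (N * a <= mu)%N ->
  (g * t <= N * (g * ne) + v * mu)%N -> (N * ne <= q * mu)%N ->
  (g * N * E <= mu * mu * (v + g * q))%N.
Proof.
move=> le1 le2 le3 le4.
apply: leq_trans (leq_mul (leqnn _) le1) _.
rewrite (_ : g * N * (a * t) = N * a * (g * t))%N; last by ring.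
apply: leq_trans (leq_mul le2 le3) _.
rewrite (_ : mu * (_ + _) = mu * (g * (N * ne)) + mu * (v * mu))%N; last by ring.
rewrite (_ : mu * mu * (v + g * q) = mu * (g * (q * mu)) + mu * (v * mu))%N; last by ring.
by apply: leq_add => //; apply: leq_mul => //; apply: leq_mul.
Qed.

(** Equivalently, [X] is injective on the span of [D]. *)
Definition extendable (X : 'M[K]_n) :=
  [exists Y in GL, [forall d in D, X *m d == Y *m d]].

(** If [r w = 1], the translates of the annihilator of [w] by [z r], for [z] in [V], are
    disjoint. *)
Lemma card_annihilator (w : V) : w != 0 ->
  (#|K| ^ n * #|[set X : 'M[K]_n | X *m w == 0%R]| <= #|{: 'M[K]_n}|)%N.
Proof.
move=> w0; have [r rw] : exists r : 'rV[K]_n, r *m w = 1%:M.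
  have /cV0Pn[i wi] := w0.
  exists ((w i 0)^-1 *: delta_mx 0 i).
  rewrite -scalemxAl -rowE; apply/matrixP => j j'.
  by rewrite !mxE !ord1 eqxx mulVf.
rewrite -[n in (_ ^ n)%N]muln1 -card_mx -[#|{: 'cV[K]_n}|]cardsT -cardsX -[#|{: 'M[K]_n}|]cardsT.
apply: (@card_le_inj _ _ _ _ (fun u : V * 'M[K]_n => u.2 + u.1 *m r)) => [u _|].
  exact: in_setT.
move=> [z X] [z' X']; rewrite !in_setX !inE /= => /eqP Xw /eqP Xw' E.
have zz : z = z'.
  have := congr1 (fun Y => Y *m w) E.
  by rewrite /= !mulmxDl Xw Xw' !add0r -!mulmxA rw !mulmx1.
by move: E; rewrite zz => /addIr ->.
Qed.

(** A matrix that is not extendable kills a nonzero combination of vectors of [D]. There are at most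
    [|K|^|D|] combinations, each killed with probability at most [|K|^-n]. *)
Lemma card_nonextendable :
  (#|K| ^ n * #|[set X | ~~ extendable X]| <= #|K| ^ #|D| * #|{: 'M[K]_n}|)%N.
Proof.
pose U : 'M[K]_(#|D|, n) := \matrix_(i < #|D|) (enum_val i)^T.
pose E (y : 'rV[K]_#|D|) : {set 'M[K]_n} :=
  [set X : 'M[K]_n | (y *m U != 0) && (X *m (y *m U)^T == 0)].
have cE y : y \in setT -> (#|K| ^ n * #|E y| <= #|{: 'M[K]_n}|)%N.
  move=> _; have [yU|yU] := eqVneq (y *m U) 0.
    by rewrite (_ : E y = set0) ?cards0 ?muln0 //; apply/setP => X; rewrite !inE yU eqxx.
  apply: leq_trans (card_annihilator (_ : (y *m U)^T != 0)).
    by rewrite leq_mul2l; apply/orP; right; apply/subset_leq_card/subsetP => X; rewrite !inE => /andP[].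
  by apply: contra_neq yU => H; rewrite -[_ *m _]trmxK H trmx0.
apply: leq_trans (_ : #|K| ^ n * #|\bigcup_(y in setT) E y| <= _)%N.
  rewrite leq_mul2l; apply/orP; right; apply/subset_leq_card/subsetP => X; rewrite inE => nX.
  have : ~~ ((U :&: kermx X^T)%MS == 0).
    apply: contra nX => /mxrank_injP/complete_unitmx[Y YU EY].
    apply/existsP; exists Y^T; rewrite inE unitmx_tr YU /=; apply/forallP => d; apply/implyP => Dd.
    apply/eqP; apply: trmx_inj; rewrite !trmx_mul trmxK.
    have -> : d^T = row (enum_rank_in Dd d) U by rewrite rowK enum_rankK_in.
    by rewrite -!row_mul EY.
  case/rowV0Pn => v; rewrite sub_capmx => /andP[/submxP[y vE] /sub_kermxP vX] v0.
  apply/bigcupP; exists y; first exact: in_setT.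
  rewrite inE -vE v0 /=; apply/eqP; apply: trmx_inj.
  by rewrite trmx_mul trmxK vX trmx0.
have le_sum : (#|\bigcup_(y in setT) E y| <= \sum_(y in setT) #|E y|)%N.
  elim/big_rec2: _ => [|y s A _ le]; first by rewrite cards0.
  exact: leq_trans (leq_card_setU _ _) (leq_add _ _).
apply: leq_trans (leq_mul (leqnn _) le_sum) _; rewrite big_distrr /=.
apply: leq_trans (leq_sum _ cE) _.
by rewrite sum_nat_const cardsT card_mx mul1n.
Qed.

(* A uniform matrix is the product of a uniform invertible one with an independent
   uniform one, and an extendable second factor may be taken invertible. *)
Lemma card_matrix_property (Pd : pred 'M[K]_n) :
  (forall X Y, {in D, forall d, X *m d = Y *m d} -> Pd X = Pd Y) ->
  (#|GL| * #|[set X | Pd X]|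
   <= #|GL| * #|[set X | ~~ extendable X]| + #|[set X in GL | Pd X]| * #|{: 'M[K]_n}|)%N.
Proof.
move=> PdE.
pose S1 := setX GL [set X | ~~ extendable X].
pose S2 := [set u : 'M[K]_n * 'M[K]_n | [&& u.1 \in GL, extendable u.2 & Pd (u.1 *m u.2)]].
have c2 : (#|S2| <= #|[set X in GL | Pd X]| * #|{: 'M[K]_n}|)%N.
  rewrite -[#|{: 'M[K]_n}|]cardsT; apply: (@card_le_fibers _ _ _ _ snd) => [u _|Y _]; first exact: in_setT.
  case ExtY : (extendable Y); last first.
    rewrite (_ : [set x in S2 | _] = set0) ?cards0 //; apply/setP => -[G Y'].
    by rewrite !inE /=; have [->|] := eqVneq Y' Y; rewrite ?andbF // ExtY /= andbF.
  have /existsP[Y' /andP[Y'U /forallP YY']] := ExtY.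
  apply: (@card_le_inj _ _ _ _ (fun u : 'M[K]_n * 'M[K]_n => u.1 *m Y')).
    move=> [G Y1]; rewrite !inE /= => /andP[/and3P[GU _ PG] /eqP EY]; rewrite EY in PG.
    rewrite inE in Y'U; rewrite unitmx_mul GU Y'U /=.
    rewrite -(PdE (G *m Y)) // => d Dd; rewrite -!mulmxA; congr (_ *m _).
    by apply/eqP; have := YY' d; rewrite Dd.
  rewrite inE in Y'U.
  move=> [G1 Y1] [G2 Y2]; rewrite !inE /= => /andP[_ /eqP->] /andP[_ /eqP->].
  by move/(can_inj (mulmxK Y'U)) ->.
apply: leq_trans (_ : #|S1 :|: S2| <= _)%N; last first.
  by apply: leq_trans (leq_card_setU _ _) _; rewrite -cardsX leq_add2l.
rewrite -cardsX.
apply: (@card_le_inj _ _ _ _ (fun u : 'M[K]_n * 'M[K]_n => (u.1, invmx u.1 *m u.2))).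
  move=> [G X] /setXP[GU]; rewrite [X \in _]inE => PX; rewrite /= in_setU in_setX GU.
  rewrite [_ \in [set _ | ~~ _]]inE [_ \in S2]inE GU; rewrite inE in GU.
  by rewrite /= mulKVmx // PX andbT orNb.
move=> [G X] [G' X'] /=; rewrite !in_setX !inE /= => /andP[GU _] _ [<-].
have GVU : invmx G \in unitmx by rewrite unitmx_inv.
by move/(can_inj (mulKmx GVU)) ->.
Qed.

Lemma punctured_sum_eq y (X Y : 'M[K]_n) : {in D, forall d, X *m d = Y *m d} ->
  punctured_sum D c y X = punctured_sum D c y Y.
Proof. by move=> E; apply: eq_bigr => d; rewrite inE => /andP[_ Dd]; rewrite E. Qed.

(** The array is [x + A d + B d' + R vec_of ([d] [d'])] with [B], [R] uniform among all matrices.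
    Row matrices [B + R m [d]] are uniform through [B], column matrices [A + R m [d']] through [R];
    [card_matrix_property] transfers the counts from [GL] to all matrices. *)
Lemma corrected_in_code_large_dim x (A : 'M[K]_n) :
  (#|D| * (#|L| * b + #|GL| * #|K| ^ #|D|)
    + #|D| * (#|violated D c| + #|GL| * #|K| ^ #|D|) < #|GL| * #|L|)%N ->
  test_sum D f x A = 0.
Proof.
move=> Hlt; set mu := #|{: 'M[K]_n}|; set ne := #|[set X | ~~ extendable X]|.
pose T := ('M[K]_n * 'M[K]_n)%type.
pose rowX (w : T) d := w.1 + w.2 *m m (coord_of d).
pose colX (w : T) d := A + w.2 *m m (coord_of d).
pose colz (w : T) d := x + w.1 *m d.
pose Prow y := [pred X | punctured_sum D c y X != - f y].
pose E1 d := [set w : T | Prow (x + A *m d)%R (rowX w d)].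
pose E2 d := [set w : T | test_sum D c (colz w d) (colX w d) != 0].
pose Tv := [set u : V * 'M[K]_n | test_sum D c u.1 u.2 != 0].
have N_gt0 : (0 < #|L|)%N by apply/card_gt0P; exists 0.
have cN : (#|L| * ne <= #|K| ^ #|D| * mu)%N by rewrite cardL card_nonextendable.
have c1 d : (#|GL| * #|L| * #|E1 d| <= mu * mu * (#|L| * b + #|GL| * #|K| ^ #|D|))%N.
  have le1 : (#|E1 d| <= #|[set X | Prow (x + A *m d)%R X]| * mu)%N.
    rewrite /mu -[#|{: 'M[K]_n}|]cardsT -cardsX.
    apply: (@card_le_inj _ _ _ _ (fun w : T => (rowX w d, w.2))).
      by move=> w; rewrite in_setX in_setT andbT !inE.
    by move=> [B R] [B' R'] _ _ /= [E ER]; move: E; rewrite /rowX /= ER => /addIr ->.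
  have := card_matrix_property (Pd := Prow (x + A *m d)%R).
  have PE X Y : {in D, forall d0, X *m d0 = Y *m d0} -> Prow (x + A *m d)%R X = Prow (x + A *m d)%R Y.
    by move=> E; rewrite /Prow /= (punctured_sum_eq _ E).
  move/(_ PE); rewrite -/ne -/mu => le2.
  have le3 := miscorrected_le (x + A *m d).
  exact: row_count le1 le2 le3 cN.
have cT : (#|GL| * #|Tv| <= #|L| * (#|GL| * ne) + #|violated D c| * mu)%N.
  rewrite /Tv (card_pair_suml (fun z X => test_sum D c z X != 0)) big_distrr /=.
  apply: leq_trans (_ : _ <= \sum_(z : V) (#|GL| * ne + #|[set X in GL | test_sum D c z X != 0%R]| * mu))%N _.
    apply: leq_sum => z _; apply: card_matrix_property => X Y E.
    by congr (_ != 0); apply: eq_bigr => d Dd; rewrite E.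
  rewrite big_split /= sum_nat_const -big_distrl /= card_mx muln1 -cardL.
  by rewrite -(card_pair_suml (fun z X => (X \in GL) && (test_sum D c z X != 0))).
have c2 d : d \in D :\ 0 ->
    (#|GL| * #|L| * #|E2 d| <= mu * mu * (#|violated D c| + #|GL| * #|K| ^ #|D|))%N.
  rewrite !inE => /andP[d0 _].
  have le1 : (#|E2 d| <= #|[set X : 'M[K]_n | X *m d == 0%R]| * #|Tv|)%N.
    apply: (@card_le_fibers _ _ _ _ (fun w : T => (colz w d, colX w d))) => [w|[z X] _].
      by rewrite !inE.
    set F := [set w in E2 d | _].
    have [->|[w0]] := set_0Vmem F; first by rewrite cards0.
    rewrite inE => /andP[_ /eqP[Ez0 EX0]].
    (* The column matrix fixes [R], and the base point fixes [B] up to matrices killing [d]. *)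
    apply: (@card_le_inj _ _ _ _ (fun w : T => w.1 - w0.1)).
      move=> w; rewrite inE => /andP[_ /eqP[Ez _]]; rewrite inE mulmxBl subr_eq0.
      by apply/eqP/(addrI x); rewrite [LHS]Ez [RHS]Ez0.
    move=> w w'; rewrite inE => /andP[_ /eqP[_ EX]]; rewrite inE => /andP[_ /eqP[_ EX']] /addIr.
    have : w.2 = w'.2.
      have /fieldrep_GL := coord_of_neq0 d0; rewrite inE => mU.
      by move: EX; rewrite -EX' => /addrI /(can_inj (mulmxK mU)).
    by case: w w' {EX EX'} => [B R] [B' R'] /= -> ->.
  have le2 := card_annihilator d0; rewrite -cardL -/mu in le2.
  exact: col_count le1 le2 cT cN.
pose U := (\bigcup_(d in D) E1 d) :|: (\bigcup_(d in D :\ 0) E2 d).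
have gN : (0 < #|GL| * #|L|)%N by rewrite muln_gt0 GLset_gt0.
have scaled_bigcup (D1 : {set V}) (E : V -> {set T}) (q : nat) : D1 \subset D ->
    {in D1, forall d, #|GL| * #|L| * #|E d| <= q}%N ->
    (#|GL| * #|L| * #|\bigcup_(d in D1) E d| <= #|D| * q)%N.
  move=> sD1 Eq; apply: leq_trans (_ : _ <= #|D1| * q)%N _; last first.
    by rewrite leq_mul2r (subset_leq_card sD1) orbT.
  rewrite -[(#|D1| * q)%N]sum_nat_const; elim/big_rec2: _ => [|d s C Dd le]; first by rewrite cards0 muln0.
  apply: leq_trans (leq_mul (leqnn _) (leq_card_setU _ _)) _.
  by rewrite mulnDr leq_add // Eq.
have mu_gt0 : (0 < mu)%N by apply/card_gt0P; exists 0.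
have ltU : (#|U| < #|[set: T]|)%N.
  rewrite -(ltn_pmul2l gN) cardsT card_prod -/mu.
  apply: leq_ltn_trans (leq_mul (leqnn _) (leq_card_setU _ _)) _; rewrite mulnDr.
  apply: leq_ltn_trans (leq_add (scaled_bigcup _ _ _ (subxx D) (fun d _ => c1 d))
     (scaled_bigcup _ _ _ (subsetDl D _) c2)) _.
  by rewrite !(mulnCA #|D|) -mulnDr [ltnRHS]mulnC ltn_pmul2l // muln_gt0 mu_gt0.
have [w wU] : exists w, w \notin U.
  have /subsetPn[w _ ?] : ~~ ([set: T] \subset U).
    by apply/negP => /subset_leq_card; rewrite leqNgt ltU.
  by exists w.
move: wU; rewrite inE negb_or => /andP[/bigcupP n1 /bigcupP n2].
pose M d d' := x + A *m d + w.1 *m d' + w.2 *m vec_of (coord_of d * coord_of d').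
apply: (@corrected_test_sum x A M) => [d Dd|d' Dd'].
  exists (rowX w d).
    by apply/eqP/negPn/negP => bad; apply: n1; exists d => //; rewrite inE.
  by move=> d' _; rewrite /M /rowX mulmxDl -(mulmxA w.2) fieldrep_act !addrA.
exists (colz w d'), (colX w d').
  by apply/eqP/negPn/negP => bad; apply: n2; exists d' => //; rewrite inE.
move=> d _; rewrite /M /colz /colX mulmxDl -(mulmxA w.2) fieldrep_act [coord_of d' * _]mulrC.
by rewrite addrA [x + _ + _]addrAC.
Qed.

End FieldAction.

(** * Numerical estimates and the codeword close to [c] *)

Lemma small_dim_count (k N g b w v n irr : nat) : (2 <= k)%N -> (0 < g)%N ->
  (100 * k ^ 4 <= N)%N -> (50 * k * b <= g)%N -> (200 * k ^ 2 * v <= N * g)%N ->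
  (w * w <= N)%N -> (irr <= (2 * w).+1)%N -> (n < 4 * k)%N ->
  (k * g + k * (N * b) + k * (g * irr + n * v) < g * N)%N.
Proof.
move=> k2 g0 HN Hb Hv Hw Hirr Hn.
have k4 : (4 <= k ^ 2)%N by rewrite (@leq_exp2r 2 k 2).
rewrite (expnD k 2 2) in HN.
have kw : (20 * (k * w) <= N)%N.
  rewrite -leq_sqr; apply: leq_trans (_ : 400 * k ^ 2 * N <= _)%N.
    by rewrite !expnMn mulnA leq_mul2l -mulnn Hw orbT.
  rewrite -mulnn leq_mul2r; apply/orP; right; apply: leq_trans HN.
  by rewrite (_ : 400 = 100 * 4)%N // -mulnA leq_mul2l leq_mul2r k4 !orbT.
have k1 : (200 * k <= N)%N.
  apply: leq_trans HN; rewrite (_ : 200 = 100 * 2)%N // -mulnA leq_mul2l /=.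
  by apply: leq_mul; [exact: leq_trans k4 | rewrite -{1}(expn1 k) leq_pexp2l // ltnW].
have gN : (0 < g * N)%N by rewrite muln_gt0 g0; lia.
(* Shares of [g N]: 1/200 for vanishing multipliers, 1/50 for miscorrected rows, 1/50 for violated
   columns, 21/200 for exceptional multipliers. *)
have A1 : (200 * (k * g) <= g * N)%N by rewrite mulnA mulnC leq_mul2l k1 orbT.
have A2 : (50 * (k * (N * b)) <= g * N)%N.
  by rewrite (_ : 50 * _ = 50 * k * b * N)%N ?leq_mul2r ?Hb ?orbT //; ring.
have A3 : (50 * (k * (n * v)) <= g * N)%N.
  rewrite [(g * N)%N]mulnC; apply: leq_trans Hv.
  rewrite (_ : 200 * k ^ 2 * v = 50 * (k * (4 * k * v)))%N; last by ring.
  by rewrite !leq_mul2l leq_mul2r (ltnW Hn) !orbT.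
have A4 : (200 * (k * (g * irr)) <= 21 * (g * N))%N.
  rewrite (_ : 200 * _ = g * (200 * (k * irr)))%N; last by ring.
  rewrite (mulnCA 21) leq_mul2l; apply/orP; right.
  have := leq_mul (leqnn k) Hirr; rewrite mulnS mulnCA.
  by move: (k * irr)%N (k * w)%N kw => y1 y2; lia.
by lia.
Qed.

(** As [4 k <= n], the loss [q^k / N] from matrices that are not extendable is at most [q^(-3 k)];
    [q^k] absorbs the factor [2 k] and [q^(2 k)] the factor 16. *)
Lemma large_dim_count (k N g b v q n : nat) : (2 <= k)%N -> (0 < g)%N -> (1 < q)%N ->
  N = (q ^ n)%N -> (50 * k * b <= g)%N -> (200 * k ^ 2 * v <= N * g)%N -> (4 * k <= n)%N ->
  (k * (N * b + g * q ^ k) + k * (v + g * q ^ k) < g * N)%N.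
Proof.
move=> k2 g0 q1 NE Hb Hv Hn.
have N0 : (0 < N)%N by rewrite NE expn_gt0 ltnW.
have q0 := ltnW q1.
have kq : (2 * k <= q ^ k)%N.
  apply: leq_trans (_ : 2 ^ k <= _)%N; last by rewrite leq_exp2r // ltnW.
  by elim: (k) k2 => // -[//|[//|j]] IH _; rewrite expnS; have := IH isT; lia.
have q16 : (16 <= q ^ (2 * k))%N.
  by apply: leq_trans (_ : q ^ 4 <= _)%N; [rewrite (@leq_exp2r 2 q 4) | rewrite leq_pexp2l // (leq_mul (leqnn 2) k2)].
have B1 : (16 * (2 * k * q ^ k) <= N)%N.
  apply: leq_trans (_ : q ^ (2 * k) * (q ^ k * q ^ k) <= _)%N.
    by rewrite leq_mul // leq_mul2r kq orbT.
  by rewrite NE -!expnD leq_pexp2l //; lia.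
have gN : (0 < g * N)%N by rewrite muln_gt0 g0.
have A1 : (50 * (k * (N * b)) <= g * N)%N.
  by rewrite (_ : 50 * _ = 50 * k * b * N)%N ?leq_mul2r ?Hb ?orbT //; ring.
have A2 : (200 * (k * v) <= g * N)%N.
  rewrite [(g * N)%N]mulnC; apply: leq_trans Hv.
  have kk : (k <= k ^ 2)%N by rewrite -{1}(expn1 k) leq_pexp2l // ltnW.
  by rewrite mulnA leq_mul2r leq_mul2l kk !orbT.
have A3 : (16 * (2 * (k * (g * q ^ k))) <= g * N)%N.
  rewrite (_ : 16 * _ = g * (16 * (2 * k * q ^ k)))%N ?leq_mul2l ?B1 ?orbT //.
  by move: (q ^ k)%N => u; ring.
by rewrite !mulnDr; lia.
Qed.

(** The array is chosen by comparing [n] with [4 k]. A crude distance bound then shows that the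
    disagreement set is sparse, and [violated_amplified] sharpens that bound by a factor [k]. *)
Lemma close_codeword (K : finFieldType) (n : nat) (Z : zmodType)
    (D : {set 'cV[K]_n}) (c : 'cV[K]_n -> Z) (g := #|GLset K n|) :
  (0 < n)%N -> 0 \in D -> (2 <= #|D|)%N -> (100 * #|D| ^ 4 <= #|K| ^ n)%N ->
  (200 * #|D| ^ 2 * #|violated D c| < #|K| ^ n * g)%N ->
  exists2 f : 'cV[K]_n -> Z, {in GLset K n, forall X z, test_sum D f z X = 0}
    & (#|D| * (#|[set x | c x != f x]| * g) <= 2 * #|violated D c|)%N.
Proof.
move=> n_gt0 D0 k2 HN Hv.
have [e e0] : exists e : 'cV[K]_n, e != 0.
  have /card_gt0P[e] : (0 < #|D :\ 0%R|)%N by move: k2; rewrite (cardsD1 0 D) D0.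
  by rewrite !inE => /andP[e0 _]; exists e.
have [f Hf] := correction_exists D0 c e0.
have g0 : (0 < g)%N := GLset_gt0 K n.
set k := #|D| in k2 HN Hv *; set v := #|violated D c| in Hf Hv *.
set N := (#|K| ^ n)%N in HN Hv.
have gE : g = (GLfix e * N.-1)%N by rewrite /g (card_GLset e0) card_mx muln1.
set h := GLfix e in Hf gE.
have h0 : (0 < h)%N by move: g0; rewrite gE muln_gt0 => /andP[].
have N4 : (2 <= N)%N.
  apply: leq_trans HN; apply: leq_trans (_ : 100 * 1 <= _)%N => //.
  by rewrite leq_mul2l expn_gt0 (leq_trans _ k2).
(* The bound of [correction_exists] divided by [g]; since [g = h (N - 1)], it is at most
   [2 k v / (N - 1)]. *)
pose b := ((2 * k * (h * v)) %/ g)%N.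
have Hmis x : (#|miscorrected D c f x| <= b)%N.
  rewrite leq_divRL // mulnC; apply: leq_trans (Hf x) _.
  by rewrite leq_mul2r leq_mul2l subset_leq_card ?orbT // subsetDl.
have gb : (N.-1 * b <= 2 * k * v)%N.
  rewrite -(leq_pmul2l h0) mulnA -gE mulnC (leq_trans (leq_trunc_div _ _)) //.
  by apply/eq_leq; ring.
have Hb : (50 * k * b <= g)%N.
  have N1 : (0 < N.-1)%N by rewrite -ltnS prednK // ltnW.
  have NN : (N <= 2 * N.-1)%N by lia.
  rewrite -(leq_pmul2l N1) -(leq_pmul2l (isT : (0 < 2)%N)).
  apply: leq_trans (_ : 100 * k * (2 * k * v) <= _)%N.
    rewrite (_ : 2 * _ = 100 * k * (N.-1 * b))%N; last by ring.
    by rewrite leq_mul2l gb orbT.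
  rewrite (_ : 100 * k * _ = 200 * k ^ 2 * v)%N; last by ring.
  by apply: leq_trans (ltnW Hv) _; rewrite mulnA leq_mul2r NN orbT.
have in_code : {in GLset K n, forall X z, test_sum D f z X = 0}.
  move=> X XU z.
  have [L [io [m [irr [[cardL m1 mD mM mio] [cirr reg]]]]]] := field_matrix_rep_exists K n_gt0.
  have [small|large] := ltnP n (4 * k); last first.
    apply: (@corrected_in_code_large_dim K n L m cardL m1 mD mM e e0 Z D c f b Hmis).
    rewrite cardL; apply: large_dim_count large => //; first exact: finNzRing_gt1.
    exact: ltnW.
  (* For [n = 1] the exceptional set need not contain 0; adding 0 keeps generic multipliers
     invertible and costs one element. *)
  have reg0 s : s \notin 0 |: irr -> forall l, exists u, l = (map_poly io u).[s].
    by rewrite !inE negb_or => /andP[_ sR]; apply: reg.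
  apply: (corrected_in_code_small_dim n_gt0 cardL m1 mD mM mio e0 reg0 Hmis z _ XU).
  - by rewrite !inE eqxx.
  rewrite cardL; apply: (@small_dim_count k N g b (#|K| ^ n./2)) small => //.
  - exact: ltnW.
  - rewrite -expnD leq_pexp2l ?(ltnW (finNzRing_gt1 K)) // addnn.
    by rewrite -{2}(odd_double_half n) leq_addl.
  - rewrite cardsU1 -add1n; apply: leq_add cirr; by case: (_ \notin _).
exists f => //.
set s := #|[set x | c x != f x]|.
(* The crude bound: at most half of [GL] miscorrects a given point. *)
have sg : (s * g <= 2 * v)%N.
  have := card_corrected D0 Hmis; rewrite -/s -/g -/v => H.
  have gb2 : (g <= 2 * (g - b))%N.
    have : (50 * 2 * b <= g)%N by apply: leq_trans Hb; rewrite leq_mul2r leq_mul2l k2 !orbT.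
    by lia.
  apply: leq_trans (leq_mul (leqnn s) gb2) _.
  by rewrite mulnCA leq_mul2l H orbT.
have amp := violated_amplified D0 c e0 in_code; rewrite -/s -/g -/v -/k -/h in amp.
have sN : (100 * k ^ 2 * s < N)%N.
  rewrite -(ltn_pmul2r g0); apply: leq_ltn_trans Hv.
  rewrite -mulnA (_ : 200 * k ^ 2 * v = 100 * k ^ 2 * (2 * v))%N; last by ring.
  by rewrite leq_mul2l sg orbT.
(* By sparsity, the pair term in [amp] is at most half of its left side. *)
have khs : (2 * (k * (h * s)) <= g)%N.
  rewrite gE (_ : 2 * (k * (h * s)) = h * (2 * k * s))%N; last by ring.
  rewrite leq_mul2l; apply/orP; right; rewrite -ltnS prednK ?(ltnW N4) //.
  apply: leq_ltn_trans sN; rewrite leq_mul2r; apply/orP; right.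
  by rewrite -mulnn mulnA leq_mul2r (leq_trans _ (leq_mul (leqnn 100) k2)) ?orbT.
have : (2 * (k * k * (h * (s * s))) <= k * (s * g))%N.
  rewrite (_ : 2 * (k * k * (h * (s * s))) = k * (s * (2 * (k * (h * s)))))%N; last by ring.
  by rewrite !leq_mul2l khs !orbT.
by lia.
Qed.

(** * Affine orbits of constraints *)

Section Orbit.
Variables (p : nat) (K : finFieldType) (n : nat) (e0 : fn p K n).
Local Notation V := 'cV[K]_n.
Local Notation AG := (affine_group K n).
Implicit Types (g h : V * 'M[K]_n) (c : fn p K n).

Definition orbit_supp g := supp (aff_fun g e0).
Definition aff_mul g h : V * 'M[K]_n := (g.1 + g.2 *m h.1, g.2 *m h.2).
Definition aff_inv g : V * 'M[K]_n := (- (invmx g.2 *m g.1), invmx g.2).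

Lemma in_orbit_supp g x : (x \in orbit_supp g) = (e0 (aff_pt_inv g x) != 0).
Proof. by rewrite inE ffunE. Qed.

Lemma aff_pt_inv_mul g h x : g \in AG -> h \in AG ->
  aff_pt_inv (aff_mul g h) x = aff_pt_inv h (aff_pt_inv g x).
Proof.
rewrite !inE => gU hU; rewrite /aff_pt_inv /=.
have -> : invmx (g.2 *m h.2) = invmx h.2 *m invmx g.2.
  have ghU : g.2 *m h.2 \in unitmx by rewrite unitmx_mul gU.
  apply: (can_inj (mulKmx ghU)); rewrite mulmxV //.
  by rewrite mulmxA -(mulmxA g.2) mulmxV // mulmx1 mulmxV.
by rewrite -mulmxA opprD addrA [invmx g.2 *m (_ - _)]mulmxBr mulKmx.
Qed.

Lemma aff_mul_in g h : g \in AG -> h \in AG -> aff_mul g h \in AG.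
Proof. by rewrite !inE unitmx_mul => -> ->. Qed.

Lemma aff_inv_in g : g \in AG -> aff_inv g \in AG.
Proof. by rewrite !inE unitmx_inv. Qed.

Lemma aff_mulVg g : g \in AG -> aff_mul (aff_inv g) g = (0, 1%:M).
Proof. by rewrite inE => gU; rewrite /aff_mul /= addNr mulVmx. Qed.

Lemma aff_mulg1 g : aff_mul g (0, 1%:M) = g.
Proof. by case: g => y X; rewrite /aff_mul /= mulmx0 addr0 mulmx1. Qed.

Lemma orbit_supp_mul g h h' : g \in AG -> h \in AG -> h' \in AG ->
  orbit_supp h = orbit_supp h' -> orbit_supp (aff_mul g h) = orbit_supp (aff_mul g h').
Proof.
move=> gU hU h'U E; apply/setP => x.
by rewrite !in_orbit_supp !aff_pt_inv_mul // -!in_orbit_supp E.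
Qed.

Definition orbit_fiber g := #|[set h in AG | orbit_supp h == orbit_supp g]|.

(** Left multiplication by [g] injects one fiber of the orbit map into another; using inverses, all
    fibers have equal size. *)
Lemma orbit_fiber_mul g h : g \in AG -> h \in AG ->
  (orbit_fiber h <= orbit_fiber (aff_mul g h))%N.
Proof.
move=> gU hU; apply: (@card_le_inj _ _ _ _ (aff_mul g)).
  move=> h' /setIdP[h'U /eqP E]; rewrite inE aff_mul_in //=.
  by apply/eqP; apply: orbit_supp_mul.
rewrite inE in gU.
move=> [y X] [y' X'] _ _ [/addrI E1 E2].
by move: E1 E2 => /(can_inj (mulKmx gU)) -> /(can_inj (mulKmx gU)) ->.
Qed.

Lemma orbit_fiber_const g : g \in AG -> orbit_fiber g = orbit_fiber (0, 1%:M).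
Proof.
move=> gU; have idU : (0, 1%:M) \in AG by rewrite inE unitmx1.
apply/eqP; rewrite eqn_leq; apply/andP; split.
  by rewrite -(aff_mulVg gU) orbit_fiber_mul ?aff_inv_in.
by rewrite -[X in (_ <= orbit_fiber X)%N](aff_mulg1 g) orbit_fiber_mul.
Qed.

Variable a : V.
Hypothesis a_supp : a \in supp e0.

Definition shifted_supp : {set V} := [set d | d + a \in supp e0].

Lemma shifted_supp0 : 0 \in shifted_supp.
Proof. by rewrite inE add0r. Qed.

Lemma card_shifted_supp : #|shifted_supp| = #|supp e0|.
Proof.
rewrite -[LHS](card_imset _ (addIr a)); apply: eq_card => x.
apply/imsetP/idP => [[d]|xs]; first by rewrite inE => da ->.
by exists (x - a); rewrite ?subrK // in_set subrK.
Qed.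

(** The base point is the image of [a] under [g]. *)
Lemma sum_orbit_supp g c : g \in AG ->
  \sum_(x in orbit_supp g) c x = test_sum shifted_supp c (g.1 + g.2 *m a) g.2.
Proof.
rewrite inE => gU; rewrite /test_sum.
rewrite (reindex (fun d => g.1 + g.2 *m a + g.2 *m d)) /=.
  apply: eq_bigl => d; rewrite in_orbit_supp inE inE /aff_pt_inv.
  rewrite (_ : _ - g.1 = g.2 *m (d + a)) ?mulKmx //.
  by rewrite mulmxDr addrAC [g.1 + _]addrC addrK addrC.
exists (fun x => invmx g.2 *m (x - (g.1 + g.2 *m a))) => x _.
  by rewrite addrC addKr mulKmx.
by rewrite mulKVmx // addrC subrK.
Qed.

Lemma dotf_orbit g c : (forall x, e0 x = 0 \/ e0 x = 1) ->
  dotf (aff_fun g e0) c = \sum_(x in orbit_supp g) c x.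
Proof.
move=> e01; rewrite /dotf [RHS]big_mkcond; apply: eq_bigr => x _.
rewrite in_orbit_supp ffunE; have [->|->] := e01 (aff_pt_inv g x).
  by rewrite eqxx mul0r.
by rewrite oner_eq0 mul1r.
Qed.

Lemma card_affine_group : #|AG| = (#|K| ^ n * #|GLset K n|)%N.
Proof.
rewrite -[n in (_ ^ n)%N]muln1 -card_mx -[#|{: 'cV[K]_n}|]cardsT -cardsX.
by apply: eq_card => -[y X]; rewrite !inE.
Qed.

Lemma card_violating_affine c :
  #|[set g in AG | \sum_(x in orbit_supp g) c x != 0]| = #|violated shifted_supp c|.
Proof.
apply/eqP; rewrite eqn_leq; apply/andP; split.
  apply: (@card_le_inj _ _ _ _ (fun g => (g.1 + g.2 *m a, g.2))).
    move=> g /setIdP[gU]; rewrite sum_orbit_supp // in_set => ->.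
    by move: gU; rewrite !inE => ->.
  by move=> [y X] [y' X'] _ _ /= [E EX]; move: E; rewrite EX => /addIr ->.
apply: (@card_le_inj _ _ _ _ (fun g => (g.1 - g.2 *m a, g.2))).
  move=> [z X]; rewrite inE /= => /andP[XU tz].
  have gU : (z - X *m a, X) \in AG by rewrite inE; rewrite inE in XU.
  by apply/setIdP; rewrite gU sum_orbit_supp //= subrK.
by move=> [y X] [y' X'] _ _ /= [E EX]; move: E; rewrite EX => /addIr ->.
Qed.

(** Every support arises from the same number [m] of group elements, and [m] cancels in the
    quotient. *)
Lemma rejE (R : realFieldType) c :
  rej R e0 c = (#|violated shifted_supp c|)%:R / (#|K| ^ n * #|GLset K n|)%:R.
Proof.
set m := orbit_fiber (0, 1%:M).
have fib : {in orbit_supp @: AG, forall y, #|[set g in AG | orbit_supp g == y]| = m}.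
  by move=> _ /imsetP[g gU ->]; apply: orbit_fiber_const.
have m0 : (m%:R : R) != 0.
  rewrite pnatr_eq0 -lt0n; apply/card_gt0P; exists (0, 1%:M).
  by rewrite inE eqxx andbT inE unitmx1.
have cE : #|AG| = (m * #|constraint_supports e0|)%N.
  have := card_uniform_fibers predT fib.
  rewrite (_ : [set x in AG | _] = AG); last by apply/setP => g; rewrite [LHS]in_set andbT.
  by rewrite (_ : [set y in _ | _] = constraint_supports e0) //; apply/setP => g; rewrite [LHS]in_set andbT.
rewrite -card_violating_affine -card_affine_group cE.
rewrite (card_uniform_fibers (fun t : {set V} => \sum_(x in t) c x != 0) fib).
by rewrite !natrM invfM mulrACA mulfV // mul1r.
Qed.

Lemma in_aff_code c : (forall x, e0 x = 0 \/ e0 x = 1) ->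
  {in GLset K n, forall X z, test_sum shifted_supp c z X = 0} -> c \in aff_code e0.
Proof.
move=> e01 tc; rewrite inE; apply/forallP => g; apply/implyP => gU.
rewrite dotf_orbit // sum_orbit_supp //; apply/eqP/tc.
by move: gU; rewrite !inE.
Qed.

End Orbit.

(** * From the counts to the testing inequality *)

Theorem theorem6p16 (R : realFieldType) (p : nat) (delta : R)
  (K : finFieldType) (n : nat) (e0 : {ffun 'cV[K]_n -> 'F_p}) :
  prime p ->
  (p.-1)%:R / p%:R < delta -> delta < 1 ->
  (0 < n)%N ->
  (forall x, e0 x = 0 \/ e0 x = 1) ->
  (2 <= #|supp e0|)%N ->
  let k : R := (#|supp e0|)%:R in
  k ^+ 4 * (128 * (1 + 15 * delta) / (7 * (1 - delta) ^+ 2))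
    <= (#|K| ^ n)%:R ->
  forall c : {ffun 'cV[K]_n -> 'F_p},
    rej R e0 c >=
    k * (7 * (1 - delta) ^+ 3 * (delta - (p.-1)%:R / p%:R)
         / (512 * (1 + 15 * delta)))
      * Num.min (dist_to_code R e0 c) (1 / k ^+ 3).
Proof.
move=> p_pr lt_pd lt_d1 n_gt0 e01 k2 k HN c.
have [a a_supp] : exists a, a \in supp e0 by apply/card_gt0P; apply: ltnW.
set D := shifted_supp e0 a.
have kD : #|D| = #|supp e0| := card_shifted_supp e0 a.
have D0 : 0 \in D := shifted_supp0 a_supp.
set P := (p.-1)%:R / p%:R in lt_pd *.
(* Hence [delta > 1/2] and [1 + 15 delta > 17/2], the source of the numerical margins below. *)
have P2 : 1 / 2 <= P.
  have p2 := prime_gt1 p_pr.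
  have p0 : (0 : R) < p%:R by rewrite ltr0n ltnW.
  rewrite ler_pdivlMr // mulrAC ler_pdivrMr ?ltr0n //.
  by rewrite mul1r -natrM ler_nat; lia.
set r := 7 * (1 - delta) ^+ 3 * (delta - P) / (512 * (1 + 15 * delta)).
have den0 : 0 < 512 * (1 + 15 * delta) by lra.
have d1 : 0 < 1 - delta by lra.
have r0 : 0 <= r.
  by rewrite divr_ge0 ?(ltW den0) // !mulr_ge0 ?exprn_ge0 ?(ltW d1) // subr_ge0 ltW.
have r_le : r <= 1 / 200.
  rewrite /r ler_pdivrMr //.
  have : (1 - delta) ^+ 3 <= 1 by rewrite exprn_ile1 ?(ltW d1) //; lra.
  have : 0 <= (1 - delta) ^+ 3 by rewrite exprn_ge0 ?(ltW d1).
  move: ((1 - delta) ^+ 3) => y y0 y1.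
  have : y * (delta - P) <= 1 * (1 / 2) by apply: ler_pM; lra.
  by rewrite -mulrA => y2; lra.
have k_gt0 : 0 < k by rewrite ltr0n ltnW.
(* The constant in the hypothesis exceeds [128 (17/2) / 7 > 155]. *)
have HN' : (100 * #|D| ^ 4 <= #|K| ^ n)%N.
  rewrite kD -(ler_nat R) natrM natrX -/k; apply: le_trans HN.
  rewrite mulrC ler_pM2l ?exprn_gt0 // ler_pdivlMr; last by rewrite mulr_gt0 ?exprn_gt0 //; lra.
  have : (1 - delta) ^+ 2 <= 1 by rewrite exprn_ile1 ?(ltW d1) //; lra.
  by move: ((1 - delta) ^+ 2) => y y1; lra.
set v := #|violated D c|; set g := #|GLset K n|; set N := (#|K| ^ n)%N.
have rE : rej R e0 c = v%:R / (N * g)%:R := rejE e0 a R c.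
have Ng0 : (0 : R) < (N * g)%:R.
  by rewrite ltr0n muln_gt0 GLset_gt0 expn_gt0 (ltnW (finNzRing_gt1 K)).
have kr0 : 0 <= k * r by rewrite mulr_ge0 ?(ltW k_gt0).
(* When the rejection is large, the term [1 / k^3] of the minimum suffices, as
   [k r / k^3 = r / k^2]. *)
have [large|small] := leP (r / k ^+ 2) (rej R e0 c).
  apply: le_trans large; apply: le_trans (_ : k * r * (1 / k ^+ 3) <= _).
    by apply: ler_wpM2l => //; rewrite ge_min lexx orbT.
  by rewrite le_eqVlt; apply/orP; left; apply/eqP; field; rewrite gt_eqF.
have Hv : (200 * #|D| ^ 2 * v < N * g)%N.
  rewrite -(ltr_nat R) 2!natrM natrX kD -/k.
  move: small; rewrite rE ltr_pdivrMr // => small.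
  have k20 : 0 < k ^+ 2 by rewrite exprn_gt0.
  apply: lt_le_trans (_ : 200 * k ^+ 2 * (r / k ^+ 2 * (N * g)%:R) <= _).
    by rewrite ltr_pM2l // mulr_gt0.
  rewrite (_ : 200 * k ^+ 2 * _ = 200 * r * (N * g)%:R); last by field; rewrite gt_eqF.
  by rewrite ger_pMl //; lra.
have kD2 : (2 <= #|D|)%N by rewrite kD.
have [f f_code] := close_codeword n_gt0 D0 kD2 HN' Hv.
rewrite kD -/v -/g; set S := [set x | c x != f x] => f_close.
pose F : {ffun 'cV[K]_n -> 'F_p} := [ffun x => f x].
have F_code : F \in aff_code e0.
  apply: (in_aff_code (a := a)) => // X XU z; rewrite -(f_code X XU z).
  by apply: eq_bigr => d _; rewrite ffunE.
have hamF : ham c F = #|S|.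
  by apply: eq_card => x; rewrite !inE ffunE.
have N0 : (0 : R) < N%:R by rewrite ltr0n expn_gt0 (ltnW (finNzRing_gt1 K)).
have g0 : (0 : R) < g%:R by rewrite ltr0n GLset_gt0.
have dist_le : dist_to_code R e0 c <= #|S|%:R / N%:R.
  by rewrite ler_pM2r ?invr_gt0 // ler_nat -hamF; apply: bigminn_le.
apply: le_trans (_ : k * r * (#|S|%:R / N%:R) <= _).
  by apply: ler_wpM2l => //; rewrite ge_min dist_le.
have f_closeR : k * (#|S|%:R * g%:R) <= 2 * v%:R.
  by rewrite -!natrM ler_nat.
rewrite rE natrM ler_pdivlMr ?mulr_gt0 //.
rewrite (_ : k * r * _ * _ = r * (k * (#|S|%:R * g%:R))); last by field; rewrite gt_eqF.
apply: le_trans (ler_wpM2l r0 f_closeR) _.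
have v0 : (0 : R) <= v%:R by rewrite ler0n.
(* The bound [r <= 1/200] absorbs the factor 2 of [close_codeword]. *)
have : r * (2 * v%:R) <= 1 / 200 * (2 * v%:R) by rewrite ler_wpM2r // mulr_ge0.
by lra.
Qed.
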